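(* Let $x_1,\dots,x_n$, $a_1,\dots,a_n$, and $c_1,\dots,c_{n+2}$ be indeterminates. For each $j=1,\dots,n$, let $P_j$ be an $A_{j-1}$ theta function of norm $(c_1\cdots c_{n+2}a_{j+1}\cdots a_n)^{-1}$. Then $$\det_{1\leq i,j\leq n}\left(x_i^{-n-1}\prod_{k=1}^{n+2}\theta(c_kx_i)\,P_j(x_i)\prod_{k=j+1}^n\theta(a_kx_i)-x_i^{n+1}\prod_{k=1}^{n+2}\theta(c_kx_i^{-1})\,P_j(x_i^{-1})\prod_{k=j+1}^n\theta(a_kx_i^{-1})\right)$$ $$=\frac{a_1\cdots a_n}{\theta(c_1\cdots c_{n+2}a_1\cdots a_n)}\prod_{i=1}^nP_i(1/a_i)\prod_{1\leq i<j\leq n+2}\theta(c_ic_j)\prod_{i=1}^nx_i^{-1}\theta(x_i^2)\prod_{1\le i<j\le n}a_jx_i^{-1}\,\theta(x_ix_j^{\pm}).$$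
   Context: Fix $p\in\mathbb C$ with $0<|p|<1$. Put $(a;p)_\infty=\prod_{j\ge0}(1-ap^j)$, $\theta(x)=\theta(x;p)=(x;p)_\infty(p/x;p)_\infty$ for $x\ne0$, and $\theta(xy^{\pm})=\theta(xy)\theta(x/y)$. A function $f$ holomorphic on $\mathbb C\setminus\{0\}$ is called an $A_{m-1}$ theta function of norm $s$ (with $m\ge1$ and $s\in\mathbb C\setminus\{0\}$) if $f(px)=\frac{(-1)^m}{s x^m}f(x)$ for all $x\neq0$. ''Indeterminates'' are understood as nonzero complex numbers, assumed generic so that no denominators vanish. *)

(* Defs.v *)
From HB Require Import structures.
From mathcomp Require Import all_boot all_order all_algebra.
From mathcomp Require Import complex.
From mathcomp Require Import all_classical all_reals all_analysis.

Set Implicit Arguments.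
Unset Strict Implicit.
Unset Printing Implicit Defensive.

Import Order.TTheory GRing.Theory Num.Theory.
Import numFieldNormedType.Exports.

Local Open Scope complex_scope.
Local Open Scope classical_set_scope.
Local Open Scope ring_scope.

(* Throughout, the complex numbers are [R[i]] for [R : realType], with the
   topology induced by the modulus [`|z|] (itself a real element of [R[i]]).
   The library attaches that topology to [R[i]^o], i.e. to [R[i]] seen as a
   normed space over itself, hence the casts to [R[i]^o] below. *)

Section EllipticFunctions.
Variable R : realType.
Implicit Types (p a x y s : R[i]) (f : R[i] -> R[i]).

Definition qpoch a p : R[i] :=
  lim ((\prod_(0 <= j < N) (1 - a * p ^+ j) : R[i]^o) @[N --> \oo]).

(* Only meaningful for [x != 0]. *)
Definition theta p x : R[i] := qpoch x p * qpoch (p / x) p.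

(* theta(x y^{+-}) *)
Definition theta_pm p x y : R[i] := theta p (x * y) * theta p (x / y).

(* The scalars of [R[i]^o] are complex, so [derivable] in the direction 1 is
   complex differentiability. The value of [f] at 0 is junk. *)
Definition holomorphic_on_punctured_plane f : Prop :=
  forall x, x != 0 -> derivable (f : R[i]^o -> R[i]^o) x 1.

(* [f] is an A_{m-1} theta function of norm [s]; note the index shift. *)
Definition A_theta p (m : nat) s f : Prop :=
  [/\ (0 < m)%N, s != 0, holomorphic_on_punctured_plane f &
      forall x, x != 0 -> f (p * x) = (-1) ^+ m / (s * x ^+ m) * f x].

End EllipticFunctions.

(* Main.v *)
Require Import Defs.
From HB Require Import structures.
From mathcomp Require Import all_boot all_order all_algebra.
From mathcomp Require Import complex.
From mathcomp Require Import all_classical all_reals all_analysis.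
From mathcomp Require Import zify ring lra.

Set Implicit Arguments.
Unset Strict Implicit.
Unset Printing Implicit Defensive.

Import Order.TTheory GRing.Theory Num.Theory.
Import numFieldNormedType.Exports.

Local Open Scope complex_scope.
Local Open Scope classical_set_scope.
Local Open Scope ring_scope.

Import ComplexField.Normc.

(** As functions of a single variable [x_i], the entries of row [i] are
    holomorphic on the punctured plane, quasi-periodic under [x -> p x] and odd
    under [x -> 1/x]. Quasi-periodicity is a recursion of step [2n + 2] between
    Laurent coefficients, so together with oddness the coefficients of index
    [1, ..., n] determine such a function: the space has dimension at most [n]
    ([C_theta_space]). Two functions of [n] points that belong to such a space
    in each variable, and vanish when two points coincide, are proportional
    ([alternating_proportional]); this is Lagrange interpolation, one point at
    a time. Hence the determinant is a constant times the type C product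
    [C_product].

    The constant is found at [x_i = c_i] for [i = 1, ..., n], where the second
    half of each entry vanishes. What remains is the type A determinant of
    [P_j(c_i) prod_(k > j) theta(a_k c_i)], evaluated in [det_A] by the same
    method: its columns lie in the [n]-dimensional space of theta functions of
    norm [1 / (c_1 ... c_(n+2))], and putting the last point equal to [1 / a_n]
    reduces [n] by one and produces the factor [P_n(1 / a_n)].

    The argument divides by theta functions and so needs generic [x] and [c]
    ([det_C_generic]). The [a_k] and [P_j] can stay fixed: multiplying the [c_k]
    by powers of a parameter [tau] with exponents of sum zero keeps the norms,
    multiplying the [x_i] by other powers makes the data generic for [tau] near
    1, and both sides are continuous.

    The complex analysis rests on one fact, [holo_eq0]: a complex differentiable
    function on the punctured plane whose Laurent coefficients all vanish is
    zero. The coefficients are limits of dyadic Riemann sums over circles, in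
    the logarithmic coordinate. That they do not depend on the circle is
    Goursat's theorem for parallelograms ([goursat]), proved for the finite sums
    themselves; the vanishing follows by testing against nonnegative
    trigonometric kernels concentrating at a point. Differentiability of theta
    comes from a second order Taylor estimate for the partial products, uniform
    in the number of factors ([derivable_qpoch]). *)

(** * Moduli and limits of complex numbers *)

(** Differentiability as a linear approximation with explicit radii, the form in
    which it is used in all estimates below. *)
Lemma derivative_linear_approx (K : numFieldType) (f : K -> K) (x l : K) :
  (fun h : K^o => h^-1 *: ((f \o shift x) (h *: 1) - f x) : K^o) @ 0^' --> (l : K^o)
  <-> forall e : K, 0 < e -> exists2 d : K, 0 < d &
    forall h, `|h| <= d -> `|f (x + h) - f x - l * h| <= e * `|h|.
Proof.
have rw (h : K) : h != 0 ->
    `|l - h^-1 *: (f (h *: 1 + x) - f x)| = `|f (x + h) - f x - l * h| / `|h|.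
  move=> h0; rewrite -normfV -normrM -normrN; congr `|_|.
  by rewrite /GRing.scale /= mulr1 (addrC h); field.
split.
  move=> /cvgrPdist_le h e e0; have := h e e0.
  rewrite near_withinE /= => /nbhs_ballP [d dp hd].
  exists (d / 2); first by rewrite divr_gt0.
  move=> k hk; have [->|k0] := eqVneq k 0.
    by rewrite addr0 subrr mulr0 subrr !normr0 mulr0.
  have hb : ball (0 : K^o) d k.
    rewrite -ball_normE /= sub0r normrN.
    by apply: le_lt_trans hk _; rewrite gtr_pMr // invf_lt1 // ltr1n.
  by have := hd k hb k0; rewrite rw // ler_pdivrMr // normr_gt0.
move=> hl; apply/cvgrPdist_le => e e0.
have [d d0 hd] := hl e e0.
rewrite near_withinE /=; apply/nbhs_ballP; exists d => //=.
move=> k; rewrite -ball_normE /= sub0r normrN => /ltW hk k0.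
by rewrite rw // ler_pdivrMr ?normr_gt0 // hd.
Qed.

Section Modulus.
Variable R : realType.
Implicit Types z w : R[i].

Lemma normCE z : `|z| = (normc z)%:C.
Proof. by []. Qed.

Lemma normc_ge0 z : 0 <= normc z.
Proof. by rewrite -ler0c -normCE normr_ge0. Qed.

Lemma normc_eq0 z : (normc z == 0) = (z == 0).
Proof. by apply/eqP/eqP => [/eq0_normc|->] //; rewrite normc0. Qed.

Lemma normc_gt0 z : (0 < normc z) = (z != 0).
Proof. by rewrite lt_def normc_ge0 andbT normc_eq0. Qed.

Lemma normc_real (r : R) : normc r%:C = `|r|.
Proof. by apply: (@complexI R); rewrite -normCE normc_def /= expr0n /= addr0 sqrtr_sqr. Qed.

Lemma normcX z n : normc (z ^+ n) = normc z ^+ n.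
Proof. by apply: (@complexI R); rewrite -normCE normrX normCE rmorphXn. Qed.

Lemma normc_distC z w : normc (z - w) = normc (w - z).
Proof. by rewrite -normcN opprB. Qed.

Lemma normc_ge_absRe z : `|complex.Re z| <= normc z.
Proof. by case: z => a b /=; rewrite -sqrtr_sqr ler_wsqrtr // lerDl sqr_ge0. Qed.

Lemma normc_ge_absIm z : `|complex.Im z| <= normc z.
Proof. by case: z => a b /=; rewrite -sqrtr_sqr ler_wsqrtr // lerDr sqr_ge0. Qed.

Lemma gt0_realE (e : R[i]) : 0 < e -> exists2 r : R, 0 < r & e = r%:C.
Proof.
by case: e => a b; rewrite ltcE /= => /andP[/eqP -> h]; exists a.
Qed.

Lemma cvgCP (u : nat -> R[i]) (l : R[i]) :
  ((u : nat -> R[i]^o) @ \oo --> (l : R[i]^o)) <->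
  (forall e : R, 0 < e ->
    exists N, forall k, (N <= k)%N -> normc (u k - l) <= e).
Proof.
split.
  move/cvgrPdist_le => h e e0.
  have /h [N _ hN] : (0 : R[i]) < e%:C by rewrite ltcR.
  exists N => k hk; have := hN k hk.
  by rewrite /= normCE lecR normc_distC.
move=> h; apply/cvgrPdist_le => e /gt0_realE[r r0 ->].
have [N hN] := h r r0; exists N => // k /= hk.
by rewrite normCE lecR normc_distC hN.
Qed.

Lemma derivableCP (f : R[i] -> R[i]) (x : R[i]) :
  derivable (f : R[i]^o -> R[i]^o) x 1 <->
  exists l, forall e : R, 0 < e -> exists2 d : R, 0 < d &
    forall h, normc h <= d -> normc (f (x + h) - f x - l * h) <= e * normc h.
Proof.
split=> [/cvg_ex [l /derivative_linear_approx hl]|[l hl]].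
  exists l => e e0; have /hl [_ /gt0_realE[d dp ->] hd] : 0 < e%:C by rewrite ltcR.
  by exists d => // h hh; rewrite -lecR rmorphM; apply: hd; rewrite normCE lecR.
apply/cvg_ex; exists l; apply/derivative_linear_approx => _ /gt0_realE[e e0 ->].
have [d d0 hd] := hl e e0; exists d%:C; rewrite ?ltcR // => h.
by rewrite !normCE lecR -rmorphM lecR; apply: hd.
Qed.

Lemma derivable_near (f : R[i] -> R[i]) (x : R[i]) (e : R) :
  derivable (f : R[i]^o -> R[i]^o) x 1 -> 0 < e ->
  exists2 d : R, 0 < d & forall y, normc (y - x) <= d -> normc (f y - f x) <= e.
Proof.
move=> /derivableCP[l hl] e0; have [d d0 hd] := hl 1 ltr01.
have l0 : 0 < normc l + 1 by rewrite ltr_wpDl ?normc_ge0.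
exists (Num.min d (e / (normc l + 1))); first by rewrite lt_min d0 divr_gt0.
move=> y; rewrite le_min => /andP[/hd]; rewrite (addrC x) subrK mul1r => h1.
rewrite ler_pdivlMr // => h2.
rewrite (_ : f y - f x = (f y - f x - l * (y - x)) + l * (y - x)); last by rewrite subrK.
by apply: le_trans (le_normcD _ _) _; rewrite normcM; lra.
Qed.

Lemma small_power (q e : R) : 0 <= q < 1 -> 0 < e -> exists n : nat, q ^+ n <= e.
Proof.
move=> /andP[q0 q1] e0; have := @cvg_geometric R 1 q.
rewrite ger0_norm // => /(_ q1) /cvgrPdist_le /(_ e e0) [n _ /(_ n (leqnn n))] /=.
by rewrite sub0r mul1r normrN ger0_norm ?exprn_ge0 // => h; exists n.
Qed.

Lemma cauchyC (u : nat -> R[i]) :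
  (forall e : R, 0 < e -> exists N, forall j k, (N <= j)%N -> (N <= k)%N ->
     normc (u j - u k) <= e) ->
  exists l : R[i], (u : nat -> R[i]^o) @ \oo --> (l : R[i]^o).
Proof.
move=> h.
have part (v : nat -> R) : (forall j k, `|v j - v k| <= normc (u j - u k)) ->
    exists l : R, forall e, 0 < e -> exists N, forall k, (N <= k)%N -> `|v k - l| <= e.
  move=> hv.
  have /cauchy_cvgP /cvg_ex[l /cvgrPdist_le hl] : cauchy (v @ \oo).
    apply: cauchy_exP => e e0.
    have [N hN] := h (e / 2) (divr_gt0 e0 (ltr0Sn _ _)).
    exists (v N); exists N => // k /= hk; rewrite -ball_normE /=.
    apply: le_lt_trans (hv _ _) _; apply: le_lt_trans (hN _ _ (leqnn _) hk) _.
    by rewrite gtr_pMr // invf_lt1 // ltr1n.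
  exists l => e /hl [N _ hN]; exists N => k hk.
  by have := hN k hk; rewrite distrC.
have [a ha] : exists l : R, forall e, 0 < e -> exists N, forall k, (N <= k)%N -> `|complex.Re (u k) - l| <= e.
  apply: part => j k; apply: le_trans (normc_ge_absRe _).
  by case: (u j) (u k) => ? ? [].
have [b hb] : exists l : R, forall e, 0 < e -> exists N, forall k, (N <= k)%N -> `|complex.Im (u k) - l| <= e.
  apply: part => j k; apply: le_trans (normc_ge_absIm _).
  by case: (u j) (u k) => ? ? [].
exists (a +i* b); apply/cvgCP => e e0.
have [N hN] := ha (e / 2) (divr_gt0 e0 (ltr0Sn _ _)).
have [M hM] := hb (e / 2) (divr_gt0 e0 (ltr0Sn _ _)).
exists (maxn N M) => k; rewrite geq_max => /andP[/hN h1 /hM h2].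
have -> : u k - (a +i* b) =
    (complex.Re (u k) - a)%:C + 'i%C * (complex.Im (u k) - b)%:C.
  by case: (u k) => c d; simpc.
apply: le_trans (le_normcD _ _) _; rewrite normcM !normc_real.
rewrite (_ : normc 'i%C = 1); last by rewrite /= expr0n /= add0r expr1n sqrtr1.
by rewrite mul1r; lra.
Qed.

End Modulus.

(** * The complex exponential *)

Section ComplexExponential.
Variable R : realType.
Implicit Types z w : R[i].

Definition expC z : R[i] :=
  (expR (complex.Re z))%:C * (cos (complex.Im z) +i* sin (complex.Im z)).

Lemma expCD z w : expC (z + w) = expC z * expC w.
Proof.
case: z w => [a b] [c d]; rewrite /expC /= expRD cosD sinD.
by simpc; congr (_ +i* _); ring.
Qed.

Lemma expC0 : expC 0 = 1.
Proof. by rewrite /expC /= expR0 cos0 sin0 mul1r. Qed.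

Lemma expC_neq0 z : expC z != 0.
Proof.
apply/eqP => h; have := expCD z (- z).
by rewrite subrr expC0 h mul0r => /eqP; rewrite oner_eq0.
Qed.

Definition twopii : R[i] := 0 +i* (pi *+ 2).

Lemma expC_twopii : expC twopii = 1.
Proof. by rewrite /expC /= expR0 cos2pi sin2pi mul1r. Qed.

Lemma twopii_neq0 : twopii != 0.
Proof. by rewrite eq_complex /= negb_and mulrn_eq0 /= (gt_eqF (pi_gt0 R)) orbT. Qed.

Lemma unit_circle_angle (a b : R) : a ^+ 2 + b ^+ 2 = 1 ->
  exists2 t, `|t| <= pi & cos t = a /\ sin t = b.
Proof.
move=> h; have ha : -1 <= a <= 1.
  by rewrite -ler_norml -sqrtr_sqr -[X in _ <= X]sqrtr1 ler_sqrt // -h lerDl sqr_ge0.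
have c : cos (acos a) = a by rewrite acosK // in_itv.
have s : sin (acos a) = `|b|.
  by rewrite sin_acos // -sqrtr_sqr; congr Num.sqrt; lra.
have n : `|acos a| <= pi by rewrite ger0_norm ?acos_ge0 ?acos_lepi.
have [b0|b0] := leP 0 b; first by exists (acos a); rewrite // s ger0_norm.
by exists (- acos a); rewrite ?normrN // cosN sinN s ltr0_norm // opprK.
Qed.

Lemma expC_surj w : w != 0 -> exists z, expC z = w.
Proof.
move=> w0; have n0 : 0 < normc w by rewrite normc_gt0.
have [r hr] := expR_total n0.
have [t _ [ct st]] : exists2 t, `|t| <= pi & cos t = complex.Re w / normc w /\ sin t = complex.Im w / normc w.
  apply: unit_circle_angle; rewrite !expr_div_n -mulrDl.
  rewrite (_ : _ + _ = normc w ^+ 2) ?mulfV ?expf_neq0 ?gt_eqF //.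
  by case: (w) => a b /=; rewrite sqr_sqrtr // addr_ge0 ?sqr_ge0.
exists (r +i* t); rewrite /expC /= hr ct st.
case: w w0 n0 hr ct st => a b w0 n0 _ _ _ /=.
simpc; congr (_ +i* _); rewrite mulrC mulfVK //; move: n0; exact: lt0r_neq0.
Qed.

Lemma real_linear_approx (f : R -> R) (x l : R) : is_derive x 1 f l ->
  forall e : R, 0 < e -> exists2 d : R, 0 < d &
    forall h, `|h| <= d -> `|f (x + h) - f x - l * h| <= e * `|h|.
Proof. by move=> [/cvg_ex[l' h]] <-; apply/derivative_linear_approx; apply/cvg_ex; exists l'. Qed.

(** By the addition formula this first order estimate at the origin is all that
    is needed for complex differentiability everywhere. *)
Lemma expC_at0 (e : R) : 0 < e -> exists2 d : R, 0 < d &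
  forall h, normc h <= d -> normc (expC h - 1 - h) <= e * normc h.
Proof.
move=> e0.
have e6 : 0 < e / 8 by rewrite divr_gt0.
have [d1 d10 h1] := real_linear_approx (is_derive_expR 0) e6.
have [d2 d20 h2] := real_linear_approx (is_derive_cos 0) e6.
have [d3 d30 h3] := real_linear_approx (is_derive_sin 0) e6.
pose d := Num.min (Num.min d1 d2) (Num.min d3 (Num.min 1 (e / 8))).
have d0 : 0 < d by rewrite !lt_min d10 d20 d30 ltr01 e6.
exists d => // -[u v] hd.
have hR : `|u| <= normc (u +i* v) := normc_ge_absRe (u +i* v).
have hI : `|v| <= normc (u +i* v) := normc_ge_absIm (u +i* v).
move: hd; rewrite !le_min => /andP[/andP[k1 k2] /andP[k3 /andP[k4 k5]]].
have := h1 u (le_trans hR k1); have := h2 v (le_trans hI k2).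
have := h3 v (le_trans hI k3).
rewrite !add0r sin0 cos0 expR0 subr0 oppr0 mul0r subr0 !mul1r => es ec eu.
rewrite /expC [X in normc X](_ : _ =
  (expR u - 1 - u)%:C * (cos v +i* sin v)
  + (1 + u)%:C * ((cos v - 1) +i* (sin v - v)) + 'i * (u * v)%:C); last first.
  by simpc; congr (_ +i* _); ring.
set m := normc (u +i* v) in hR hI k4 k5 *.
have m0 : 0 <= m by exact: normc_ge0.
have cs (a b : R) : normc (a +i* b) <= `|a| + `|b|.
  rewrite (_ : a +i* b = a%:C + 'i * b%:C); last by simpc.
  apply: le_trans (le_normcD _ _) _; rewrite normcM !normc_real lerD2l.
  by rewrite /= expr0n expr1n add0r sqrtr1 mul1r.
have n1 : normc (cos v +i* sin v) = 1 by rewrite /= cos2Dsin2 sqrtr1.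
have ni : normc ('i : R[i]) = 1 by rewrite /= expr0n expr1n add0r sqrtr1.
have A1 : normc ((expR u - 1 - u)%:C * (cos v +i* sin v)) <= e / 8 * m.
  rewrite normcM n1 mulr1 normc_real; apply: le_trans eu _.
  by rewrite ler_pM2l.
have A2 : normc ((1 + u)%:C * ((cos v - 1) +i* (sin v - v))) <= 2 * (e / 8 * m + e / 8 * m).
  rewrite normcM normc_real; apply: ler_pM; rewrite ?normc_ge0 //.
    by apply: le_trans (ler_normD _ _) _; rewrite normr1; lra.
  apply: le_trans (cs _ _) _; apply: lerD.
    by apply: le_trans ec _; rewrite ler_pM2l.
  by apply: le_trans es _; rewrite ler_pM2l.
have A3 : normc ('i * (u * v)%:C) <= e / 8 * m.
  rewrite normcM ni mul1r normc_real normrM.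
  apply: ler_pM => //; exact: le_trans hR k5.
apply: le_trans (le_normcD _ _) _; apply: le_trans (lerD (le_normcD _ _) (lexx _)) _.
by nra.
Qed.

Lemma derivable_expC z : derivable (expC : R[i]^o -> R[i]^o) z 1.
Proof.
apply/derivableCP; exists (expC z) => e e0.
have n0 : 0 < normc (expC z) by rewrite normc_gt0 expC_neq0.
have [d d0 hd] := expC_at0 (divr_gt0 e0 n0); exists d => // h /hd {}hd.
rewrite expCD (_ : _ - _ = expC z * (expC h - 1 - h)); last by ring.
rewrite normcM; apply: le_trans (ler_wpM2l (normc_ge0 _) hd) _.
by rewrite mulrA (mulrC _ (e / _)) divfK // gt_eqF.
Qed.

End ComplexExponential.

(** * Dyadic means and Goursat's lemma *)

Section DyadicAverages.
Variable R : realType.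
Local Notation C := R[i].
Implicit Types (a b c z w : C) (g f : C -> C).

(** Midpoint Riemann sums with [2^N] nodes, by recursion on the halves of the
    segment: the recursion makes additivity under halving an exact identity at
    every finite stage, so Goursat's argument needs no integral. *)
Fixpoint dyadic_mean N g a b : C :=
  if N is N'.+1 then
    (dyadic_mean N' g a ((a + b) / 2) + dyadic_mean N' g ((a + b) / 2) b) / 2
  else g ((a + b) / 2).

Lemma dyadic_mean_affine N (al be : C) a b :
  dyadic_mean N (fun z => al + be * z) a b = al + be * ((a + b) / 2).
Proof. by elim: N a b => [//|N IH] a b /=; rewrite !IH; field. Qed.

Lemma dyadic_mean_cst N (al : C) a b : dyadic_mean N (fun=> al) a b = al.
Proof. by elim: N a b => [//|N IH] a b /=; rewrite !IH; field. Qed.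

Lemma dyadic_meanD N f g a b :
  dyadic_mean N (fun z => f z + g z) a b = dyadic_mean N f a b + dyadic_mean N g a b.
Proof. by elim: N a b => [//|N IH] a b /=; rewrite !IH; field. Qed.

Lemma dyadic_meanZ N c g a b :
  dyadic_mean N (fun z => c * g z) a b = c * dyadic_mean N g a b.
Proof. by elim: N a b => [//|N IH] a b /=; rewrite !IH; field. Qed.

Lemma dyadic_mean_shift N g a b c :
  dyadic_mean N g (a + c) (b + c) = dyadic_mean N (fun z => g (z + c)) a b.
Proof.
elim: N a b => [|N IH] a b /=; first by congr g; field.
rewrite -!IH; suff -> : (a + c + (b + c)) / 2 = (a + b) / 2 + c by [].
by field.
Qed.

Lemma eq_dyadic_mean N f g a b : f =1 g -> dyadic_mean N f a b = dyadic_mean N g a b.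
Proof. by move=> h; elim: N a b => [|N IH] a b /=; rewrite ?h // !IH. Qed.

Lemma dyadic_mean_le (K : C -> Prop) N f (psi : C -> C) a b :
  (forall z w, K z -> K w -> K ((z + w) / 2)) ->
  (forall z, K z -> `|f z| <= psi z) -> K a -> K b ->
  `|dyadic_mean N f a b| <= dyadic_mean N psi a b.
Proof.
move=> Kmid hf; elim: N a b => [|N IH] a b Ka Kb /=; first exact/hf/Kmid.
rewrite normrM normfV (ger0_norm (ler0n _ 2)) ler_pM2r ?invr_gt0 ?ltr0n //.
by apply: le_trans (ler_normD _ _) _; apply: lerD; apply: IH => //; apply: Kmid.
Qed.

Lemma dyadic_mean_ball N g z0 (r e : R) a b :
  (forall z, normc (z - z0) <= r -> normc (g z) <= e) ->
  normc (a - z0) <= r -> normc (b - z0) <= r ->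
  normc (dyadic_mean N g a b) <= e.
Proof.
move=> h ha hb; rewrite -lecR -normCE -[X in _ <= X](dyadic_mean_cst N _ a b).
apply: (dyadic_mean_le (K := fun z => normc (z - z0) <= r)) => //.
  move=> z w hz hw.
  rewrite (_ : (z + w) / 2 - z0 = (2^-1)%:C * ((z - z0) + (w - z0))); last first.
    by rewrite fmorphV rmorph_nat; field.
  rewrite normcM normc_real ger0_norm ?invr_ge0 // ler_pdivrMl //.
  by apply: le_trans (le_normcD _ _) _; lra.
by move=> z hz; rewrite normCE lecR h.
Qed.

Lemma half_pow_normc n : normc ((2^-1 : C) ^+ n) = (2^-1 : R) ^+ n.
Proof.
rewrite normcX (_ : (2^-1 : C) = (2^-1)%:C); last by rewrite fmorphV rmorph_nat.
by rewrite normc_real ger0_norm // invr_ge0.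
Qed.

(** Otherwise some part of every bad cell is bad, and the nested bad cells
    shrink to a point, near which no small cell is bad. The cell of depth [n]
    at [z] stands for [z + 2^-n * K] with [K] a fixed segment or parallelogram,
    and its parts are the half-sized cells at [z + 2^-(n+1) * d], [d] in [D]. *)
Lemma bisection (D : seq C) (B : R) (T : C -> nat -> Prop) :
  (forall d, d \in D -> normc d <= B) ->
  (forall z n, (forall d, d \in D -> T (z + (2^-1) ^+ n.+1 * d) n.+1) -> T z n) ->
  (forall z0, exists2 r : R, 0 < r & forall z n,
     normc (z - z0) <= (2^-1) ^+ n * B -> (2^-1) ^+ n <= r -> T z n) ->
  forall z, T z 0%N.
Proof.
move=> hD hstep hloc z; apply: contrapT => nT.
have hex (zn : C * nat) : exists d, ~ T zn.1 zn.2 ->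
    d \in D /\ ~ T (zn.1 + (2^-1) ^+ zn.2.+1 * d) zn.2.+1.
  case: zn => y n /=; case: (pselect (T y n)) => [t|nt]; first by exists 0.
  suff [d [h1 h2]] : exists d, d \in D /\ ~ T (y + (2^-1) ^+ n.+1 * d) n.+1.
    by exists d.
  apply: contrapT => hn; apply: nt; apply: hstep => d dD.
  by apply: contrapT => hT; apply: hn; exists d.
have [next hnext] := choice hex.
pose u := fix u n := if n is m.+1 then u m + (2^-1) ^+ m.+1 * next (u m, m) else z.
have bad n : ~ T (u n) n.
  by elim: n => [//|n IH]; have [_] := hnext (u n, n) IH.
have nxt n : next (u n, n) \in D by have [] := hnext (u n, n) (bad n).
have p2 n : 0 < (2^-1 : R) ^+ n by rewrite exprn_gt0.
have B0 : 0 <= B by apply: le_trans (hD _ (nxt 0%N)); exact: normc_ge0.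
have step n k : normc (u (n + k)%N - u n) <= (2^-1) ^+ n * B * (1 - (2^-1) ^+ k).
  elim: k => [|k IH]; first by rewrite addn0 subrr normc0 expr0 subrr mulr0.
  rewrite addnS /= (_ : _ - _ = u (n + k)%N - u n
    + (2^-1) ^+ (n + k).+1 * next (u (n + k)%N, (n + k)%N)); last by ring.
  apply: le_trans (le_normcD _ _) _; rewrite normcM half_pow_normc.
  apply: le_trans (lerD IH (ler_wpM2l (ltW (p2 _)) (hD _ (nxt _)))) _.
  rewrite -addnS exprD exprS le_eqVlt; apply/orP; left; apply/eqP.
  by field.
have step' n k : (n <= k)%N -> normc (u k - u n) <= (2^-1) ^+ n * B.
  move=> /subnKC <-; apply: le_trans (step _ _) _.
  by rewrite ler_piMr ?mulr_ge0 ?(ltW (p2 _)) // gerBl ltW.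
have small (e : R) : 0 < e -> exists n, (2^-1 : R) ^+ n <= e.
  by move=> e0; apply: small_power => //; rewrite invr_ge0 ler0n invf_lt1 // ltr1n.
have [z0 /cvgCP hz0] : exists l : C, (u : nat -> R[i]^o) @ \oo --> (l : R[i]^o).
  apply: cauchyC => e e0.
  have B1 : 0 < B + B + 1 by lra.
  have [n hn] := small (e / (B + B + 1)) (divr_gt0 e0 B1).
  exists n => j k hj hk.
  rewrite (_ : u j - u k = (u j - u n) + (u n - u k)); last by ring.
  apply: le_trans (le_normcD _ _) _; rewrite (normc_distC (u n)).
  apply: le_trans (lerD (step' _ _ hj) (step' _ _ hk)) _.
  move: hn; rewrite ler_pdivlMr // => hn; apply: le_trans hn.
  by rewrite -mulrDr; apply: ler_wpM2l; rewrite ?(ltW (p2 _)) // lerDl.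
have close n : normc (u n - z0) <= (2^-1) ^+ n * B.
  apply/ler_addgt0Pr => e e0; have [N hN] := hz0 e e0.
  rewrite (_ : u n - z0 = (u (maxn n N) - z0) - (u (maxn n N) - u n)); last by ring.
  apply: le_trans (le_normcD _ _) _; rewrite normcN addrC; apply: lerD.
    by rewrite step' // leq_maxl.
  by rewrite hN // leq_maxr.
have [r r0 hr] := hloc z0; have [n hn] := small r r0.
exact: bad (hr _ _ (close n) hn).
Qed.

(** The discretized integral of [G] along the boundary of the parallelogram
    with corner [z] and sides [s] and [t]. *)
Definition contour_sum N G z (s t : C) : C :=
  s * (dyadic_mean N G z (z + s) - dyadic_mean N G (z + t) (z + t + s))
  + t * (dyadic_mean N G (z + s) (z + s + t) - dyadic_mean N G z (z + t)).

Lemma contour_sum_subdivide N G z s t :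
  contour_sum N.+1 G z s t =
    contour_sum N G z (s / 2) (t / 2) + contour_sum N G (z + s / 2) (s / 2) (t / 2)
    + (contour_sum N G (z + t / 2) (s / 2) (t / 2)
    + contour_sum N G (z + s / 2 + t / 2) (s / 2) (t / 2)).
Proof.
rewrite /contour_sum /=.
have e1 : (z + (z + s)) / 2 = z + s / 2 by field.
have e2 : (z + (z + t)) / 2 = z + t / 2 by field.
have e3 : (z + t + (z + t + s)) / 2 = z + t + s / 2 by field.
have e4 : (z + s + (z + s + t)) / 2 = z + s + t / 2 by field.
rewrite e1 e2 e3 e4.
have f1 : z + s / 2 + s / 2 = z + s by field.
have f2 : z + t / 2 + t / 2 = z + t by field.
have f3 : z + s / 2 + t / 2 + s / 2 = z + s + t / 2 by field.
have f4 : z + s / 2 + t / 2 + t / 2 = z + t + s / 2 by field.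
have f5 : z + t / 2 + s / 2 = z + s / 2 + t / 2 by field.
have f6 : z + t + s / 2 + s / 2 = z + t + s by field.
have f7 : z + s + t / 2 + t / 2 = z + s + t by field.
by rewrite !(f1, f2, f3, f4, f5, f6, f7); field.
Qed.

(** Affine functions have vanishing contour sums, so only the deviation from
    the tangent counts. *)
Lemma contour_sum_small N G z0 (al be : C) z s t (r e : R) :
  (forall y, normc (y - z0) <= r -> normc (G y - (al + be * y)) <= e) ->
  normc (z - z0) <= r -> normc (z + s - z0) <= r -> normc (z + t - z0) <= r ->
  normc (z + s + t - z0) <= r ->
  normc (contour_sum N G z s t) <= 2 * (normc s + normc t) * e.
Proof.
move=> h h1 h2 h3 h4.
have E a b : dyadic_mean N G a b = dyadic_mean N (fun y => G y - (al + be * y)) a b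
    + (al + be * ((a + b) / 2)).
  rewrite -(dyadic_mean_affine N) -dyadic_meanD.
  by apply: eq_dyadic_mean => y; rewrite subrK.
have h5 : normc (z + t + s - z0) <= r by rewrite (addrAC z).
rewrite /contour_sum !E; set G' := fun y => _.
have b1 := dyadic_mean_ball N h h1 h2.
have b2 := dyadic_mean_ball N h h3 h5.
have b3 := dyadic_mean_ball N h h2 h4.
have b4 := dyadic_mean_ball N h h1 h3.
rewrite (_ : _ + _ = s * (dyadic_mean N G' z (z + s) - dyadic_mean N G' (z + t) (z + t + s))
  + t * (dyadic_mean N G' (z + s) (z + s + t) - dyadic_mean N G' z (z + t))); last by field.
apply: le_trans (le_normcD _ _) _; rewrite !normcM.
have d1 := le_normcD (dyadic_mean N G' z (z + s)) (- dyadic_mean N G' (z + t) (z + t + s)).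
have d2 := le_normcD (dyadic_mean N G' (z + s) (z + s + t)) (- dyadic_mean N G' z (z + t)).
rewrite !normcN in d1 d2.
have k1 := ler_wpM2l (normc_ge0 s) (le_trans d1 (lerD b1 b2)).
have k2 := ler_wpM2l (normc_ge0 t) (le_trans d2 (lerD b3 b4)).
by lra.
Qed.

(** At depth [n] a bound of the order of [4^-n] is preserved when four cells are
    glued together. It holds for small cells near a point of differentiability
    because perimeter and distance to the tangent are both of the order of
    [2^-n], the latter with an arbitrarily small factor. *)
Lemma goursat G s t : (forall z, derivable (G : R[i]^o -> R[i]^o) z 1) ->
  forall z (e : R), 0 < e ->
  exists N0, forall N, (N0 <= N)%N -> normc (contour_sum N G z s t) <= e.
Proof.
move=> hG z e e0.
pose h n : C := (2^-1) ^+ n.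
pose T z n := exists N0, forall N, (N0 <= N)%N ->
  normc (contour_sum N G z (h n * s) (h n * t)) <= e * ((2^-1) ^+ n) ^+ 2.
suff : T z 0%N.
  by rewrite /T /h !expr0 expr1n mulr1 !mul1r.
pose B := normc s + normc t.
have B0 : 0 <= B by rewrite addr_ge0 ?normc_ge0.
apply: (@bisection [:: 0; s; t; s + t] B).
- move=> d; rewrite !inE => /or4P[] /eqP->; rewrite /B ?normc0 //.
  + by rewrite lerDl normc_ge0.
  + by rewrite lerDr normc_ge0.
  + exact: le_normcD.
- move=> y n hT.
  have hS x : h n.+1 * x = h n * x / 2 by rewrite /h exprSr; field.
  have [N1 k1] := hT 0 (mem_head _ _).
  have [|N2 k2] := hT s; first by rewrite !inE eqxx orbT.
  have [|N3 k3] := hT t; first by rewrite !inE eqxx !orbT.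
  have [|N4 k4] := hT (s + t); first by rewrite !inE eqxx !orbT.
  exists (maxn (maxn N1 N2) (maxn N3 N4)).+1 => -[//|N].
  rewrite ltnS !geq_max => /andP[/andP[n1 n2] /andP[n3 n4]].
  move: {k1 k2 k3 k4} (k1 N n1) (k2 N n2) (k3 N n3) (k4 N n4).
  rewrite contour_sum_subdivide -/(h n.+1) mulr0 addr0 mulrDr addrA !hS => k1 k2 k3 k4.
  apply: le_trans (le_normcD _ _) _.
  apply: le_trans (lerD (le_normcD _ _) (le_normcD _ _)) _.
  have q4 : ((2^-1 : R) ^+ n.+1) ^+ 2 = ((2^-1) ^+ n) ^+ 2 / 4 by rewrite (exprSr _ n); field.
  by rewrite q4 in k1 k2 k3 k4; lra.
move=> z0; have [l hl] := (derivableCP _ _).1 (hG z0).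
have D0 : 0 < 4 * B ^+ 2 + 1 by rewrite ltr_wpDl // mulr_ge0 // sqr_ge0.
have [d d0 hd] := hl _ (divr_gt0 e0 D0).
have B1 : 0 < 2 * B + 1 by lra.
exists (d / (2 * B + 1)); first exact: divr_gt0.
move=> y n hy hn; exists 0%N => N _.
set q := (2^-1 : R) ^+ n in hy hn *.
have q0 : 0 < q by rewrite exprn_gt0.
have hs : normc (h n * s) = q * normc s by rewrite normcM half_pow_normc.
have ht : normc (h n * t) = q * normc t by rewrite normcM half_pow_normc.
have rd : 2 * (q * B) <= d.
  move: hn; rewrite ler_pdivlMr // => hn; apply: le_trans hn; lra.
have sB : 0 <= normc s <= B by rewrite normc_ge0 lerDl normc_ge0.
have tB : 0 <= normc t <= B by rewrite normc_ge0 lerDr normc_ge0.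
have near_y x : normc x <= q * B -> normc (y + x - z0) <= 2 * (q * B).
  move=> hx; rewrite (addrAC y); apply: le_trans (le_normcD _ _) _; lra.
set e1 := e / (4 * B ^+ 2 + 1) in hd.
have e10 : 0 < e1 by exact: divr_gt0.
have -> : e * q ^+ 2 = (4 * B ^+ 2 + 1) * e1 * q ^+ 2.
  by rewrite /e1 (mulrC (4 * _ + 1)) divfK // gt_eqF.
apply: le_trans (_ : 2 * (normc (h n * s) + normc (h n * t)) * (e1 * (2 * (q * B))) <= _).
  apply: (@contour_sum_small _ _ z0 (G z0 - l * z0) l _ _ _ (2 * (q * B))).
  - move=> x hx; rewrite (_ : _ - _ = G (z0 + (x - z0)) - G z0 - l * (x - z0)).
      apply: le_trans (hd _ (le_trans hx rd)) _.
      by rewrite ler_pM2l.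
    by rewrite (addrC z0) subrK; ring.
  - by rewrite -[y]addr0; apply: near_y; rewrite normc0 mulr_ge0 // ltW.
  - by apply: near_y; rewrite hs ler_pM2l //; case/andP: sB.
  - by apply: near_y; rewrite ht ler_pM2l //; case/andP: tB.
  - rewrite -(addrA y); apply: near_y; apply: le_trans (le_normcD _ _) _.
    by rewrite hs ht -mulrDr.
rewrite hs ht -mulrDr -/B.
have : 0 <= e1 * q ^+ 2 by rewrite mulr_ge0 // ?sqr_ge0 // ltW.
move=> hh; lra.
Qed.

End DyadicAverages.

(** * Holomorphic functions on the punctured plane *)

Section Holomorphic.
Variable R : realType.
Local Notation C := R[i].
Local Notation holo := (@holomorphic_on_punctured_plane R).
Implicit Types (f g : C -> C).

Lemma eq_holo f g : (forall x, x != 0 -> f x = g x) -> holo f -> holo g.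
Proof.
move=> h hf x x0; have [l hl] := (derivableCP _ _).1 (hf x x0).
apply/derivableCP; exists l => e /hl [d d0 hd].
pose r := Num.min d (normc x / 2).
have n0 : 0 < normc x by rewrite normc_gt0.
exists r; first by rewrite lt_min d0 divr_gt0.
move=> k; rewrite le_min => /andP[/hd hk k2].
rewrite -!h //; apply/eqP => e0; move: k2.
rewrite -normcN -(add0r (- k)) -e0 addrK; lra.
Qed.

Lemma holo_cst (c : C) : holo (fun=> c).
Proof. by move=> x _; apply: derivable_cst. Qed.

Lemma holo_id : holo id.
Proof. by move=> x _; apply: derivable_id. Qed.

Lemma holoD f g : holo f -> holo g -> holo (fun x => f x + g x).
Proof. by move=> hf hg x x0; exact: (@derivableD _ _ _ (f : C^o -> C^o) g x 1 (hf x x0) (hg x x0)). Qed.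

Lemma holoM f g : holo f -> holo g -> holo (fun x => f x * g x).
Proof. by move=> hf hg x x0; exact: (@derivableM _ _ (f : C^o -> C^o) g x 1 (hf x x0) (hg x x0)). Qed.

Lemma holoN f : holo f -> holo (fun x => - f x).
Proof. by move=> hf x x0; exact: (@derivableN _ _ _ (f : C^o -> C^o) x 1 (hf x x0)). Qed.

Lemma holoB f g : holo f -> holo g -> holo (fun x => f x - g x).
Proof. by move=> hf hg; exact: holoD hf (holoN hg). Qed.

Lemma derivable_compC f g (x : C) :
  derivable (g : R[i]^o -> R[i]^o) x 1 -> derivable (f : R[i]^o -> R[i]^o) (g x) 1 ->
  derivable ((fun y => f (g y)) : R[i]^o -> R[i]^o) x 1.
Proof.
by move=> /derivable1_diffP hg /derivable1_diffP hf; apply/derivable1_diffP; exact: (differentiable_comp hg hf).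
Qed.

Lemma holoV f : (forall x, x != 0 -> f x != 0) -> holo f -> holo (fun x => (f x)^-1).
Proof.
by move=> h0 hf x x0; exact: (@derivableV _ _ (f : C^o -> C^o) x 1 (h0 x x0) (hf x x0)).
Qed.

Lemma holoX f n : holo f -> holo (fun x => f x ^+ n).
Proof.
move=> hf; elim: n => [|n IH]; first exact: holo_cst.
by apply: (eq_holo (f := fun x => f x * f x ^+ n)) => [x _|]; [rewrite exprS|exact: holoM].
Qed.

Lemma holo_comp f g : (forall x, x != 0 -> g x != 0) -> holo f -> holo g ->
  holo (fun x => f (g x)).
Proof. by move=> h0 hf hg x x0; apply: derivable_compC; [exact: hg|exact/hf/h0]. Qed.

Lemma holo_sum (I : Type) (r : seq I) (P : pred I) (F : I -> C -> C) :
  (forall i, P i -> holo (F i)) -> holo (fun x => \sum_(i <- r | P i) F i x).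
Proof.
move=> h; elim: r => [|i r IH].
  by apply: (eq_holo (f := fun=> 0)) => [x _|]; [rewrite big_nil|exact: holo_cst].
have [Pi|nPi] := boolP (P i).
  apply: (eq_holo (f := fun x => F i x + \sum_(j <- r | P j) F j x)) => [x _|].
    by rewrite big_cons Pi.
  exact: holoD (h _ Pi) IH.
by apply: eq_holo IH => x _; rewrite big_cons (negbTE nPi).
Qed.

Lemma holoXz (k : int) : holo (fun x => x ^ k).
Proof.
case: k => n; first exact: holoX holo_id.
apply: (eq_holo (f := fun x => (x ^+ n.+1)^-1)) => [x _|]; first by [].
have h0 (x : C) : x != 0 -> x ^+ n.+1 != 0 by move=> x0; rewrite expf_neq0.
exact: holoV h0 (@holoX _ n.+1 holo_id).
Qed.

Lemma holo_scale f (w : C) : w != 0 -> holo f -> holo (fun x => f (w * x)).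
Proof.
move=> w0 hf; have h0 (x : C) : x != 0 -> w * x != 0 by move=> x0; rewrite mulf_neq0.
by have h := @holo_comp f (fun x => w * x) h0 hf; apply: h; exact: holoM (@holo_cst w) holo_id.
Qed.

Lemma holo_inv f : holo f -> holo (fun x => f x^-1).
Proof.
move=> hf; have h0 (x : C) : x != 0 -> x^-1 != 0 by rewrite invr_eq0.
by have h := @holo_comp f (fun x => x^-1) h0 hf; apply: h; exact: (holoV (f := id) (fun x x0 => x0) holo_id).
Qed.

End Holomorphic.

(** * Means over circles *)

Section CircleMean.
Variable R : realType.
Local Notation C := R[i].
Local Notation holo := (@holomorphic_on_punctured_plane R).
Implicit Types (f g : C -> C).

(** The Cauchy property is local, by continuity, and passes from the halves of a
    segment to the segment. *)
Lemma dyadic_mean_is_cvg g a b : (forall z, derivable (g : C^o -> C^o) z 1) ->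
  exists l : C, (fun N => dyadic_mean N g a b : C^o) @ \oo --> (l : C^o).
Proof.
move=> hg; apply: cauchyC => e e0.
pose h n : C := (2^-1) ^+ n.
pose T z n := exists N0, forall j k, (N0 <= j)%N -> (N0 <= k)%N ->
  normc (dyadic_mean j g z (z + h n * (b - a)) - dyadic_mean k g z (z + h n * (b - a))) <= e.
suff : T a 0%N.
  by rewrite /T /h expr0 mul1r (addrC a) subrK.
pose B := normc (b - a).
have B0 : 0 <= B by exact: normc_ge0.
apply: (@bisection _ [:: 0; b - a] B).
- by move=> d; rewrite !inE => /orP[] /eqP->; rewrite ?normc0.
- move=> y n hT.
  have hS : y + h n.+1 * (b - a) = (y + (y + h n * (b - a))) / 2.
    by rewrite /h exprSr; field.
  have [N1 k1] := hT 0 (mem_head _ _).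
  have [|N2 k2] := hT (b - a); first by rewrite !inE eqxx orbT.
  exists (maxn N1 N2).+1 => -[//|j] [//|k]; rewrite !ltnS !geq_max.
  move=> /andP[j1 j2] /andP[i1 i2] /=; rewrite -!hS.
  have := k1 j k j1 i1; have := k2 j k j2 i2.
  rewrite mulr0 addr0 -/(h n.+1).
  have -> : y + h n.+1 * (b - a) + h n.+1 * (b - a) = y + h n * (b - a).
    by rewrite /h exprSr; field.
  set m := y + h n.+1 * _; set r := y + h n * _ => l2 l1.
  rewrite (_ : _ - _ = (2^-1)%:C *
     ((dyadic_mean j g y m - dyadic_mean k g y m)
      + (dyadic_mean j g m r - dyadic_mean k g m r))); last first.
    by rewrite fmorphV rmorph_nat; field.
  rewrite normcM normc_real ger0_norm ?invr_ge0 // ler_pdivrMl //.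
  by apply: le_trans (le_normcD _ _) _; lra.
move=> z0; have e2 : 0 < e / 2 by rewrite divr_gt0.
have [r r0 near_z] := derivable_near (hg z0) e2.
have B1 : 0 < 2 * B + 1 by lra.
exists (r / (2 * B + 1)); first exact: divr_gt0.
move=> y n hy hn; exists 0%N => j k _ _.
set q := (2^-1 : R) ^+ n in hy hn.
have q0 : 0 < q by rewrite exprn_gt0.
have rd : 2 * (q * B) <= r.
  move: hn; rewrite ler_pdivlMr // => hn; apply: le_trans hn; lra.
have hy2 : normc (y - z0) <= r.
  apply: le_trans hy _; apply: le_trans rd.
  by rewrite mulr_natl mulr2n lerDl mulr_ge0 // ltW.
have hr2 : normc (y + h n * (b - a) - z0) <= r.
  apply: le_trans rd; rewrite addrAC; apply: le_trans (le_normcD _ _) _.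
  by rewrite normcM half_pow_normc mulr_natl mulr2n lerD.
have E i : dyadic_mean i g y (y + h n * (b - a)) =
    dyadic_mean i (fun x => g x - g z0) y (y + h n * (b - a)) + g z0.
  rewrite -[in RHS](dyadic_mean_cst i (g z0) y (y + h n * (b - a))) -dyadic_meanD.
  by apply: eq_dyadic_mean => x; rewrite dyadic_mean_cst subrK.
rewrite !E opprD addrACA subrr addr0 (_ : e = e / 2 + e / 2); last by lra.
apply: le_trans (le_normcD _ _) _; rewrite normcN; apply: lerD.
  exact: dyadic_mean_ball near_z hy2 hr2.
exact: dyadic_mean_ball near_z hy2 hr2.
Qed.

Lemma derivable_holo_expC f : holo f ->
  forall z, derivable ((fun z => f (expC z)) : C^o -> C^o) z 1.
Proof.
move=> hf z; apply: (derivable_compC (f := f) (g := @expC R)); first exact: derivable_expC.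
exact/hf/expC_neq0.
Qed.

(** The integral of [f(x) dx / (2 pi i x)] over the unit circle. *)
Definition circle_mean f : C :=
  lim ((fun N => dyadic_mean N (fun z => f (expC z)) 0 (twopii R) : C^o) @ \oo).

Lemma circle_meanE f (l : C) :
  (fun N => dyadic_mean N (fun z => f (expC z)) 0 (twopii R) : C^o) @ \oo --> (l : C^o) ->
  circle_mean f = l.
Proof. exact: (@cvg_lim C^o (@norm_hausdorff _ _)). Qed.

Lemma circle_mean_cvg0 f : holo f ->
  (fun N => dyadic_mean N (fun z => f (expC z)) 0 (twopii R) : C^o) @ \oo
    --> (circle_mean f : C^o).
Proof.
move=> /derivable_holo_expC /dyadic_mean_is_cvg hf.
by have [l hl] := hf 0 (twopii R); apply/cvg_ex; exists l.
Qed.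

(** In the logarithmic coordinate two circles about the origin span a
    parallelogram whose other two sides differ by a period of the exponential,
    so that their contributions cancel. Since the side joining the two starting
    points is arbitrary, this covers changes of radius and rotations alike. *)
Lemma circle_mean_cvg f z : holo f ->
  (fun N => dyadic_mean N (fun z => f (expC z)) z (z + twopii R) : C^o) @ \oo
    --> (circle_mean f : C^o).
Proof.
move=> hf; apply/cvgCP => e e0.
have e2 : 0 < e / 2 by rewrite divr_gt0.
have [N1 h1] := (cvgCP _ _).1 (circle_mean_cvg0 hf) _ e2.
have t0 : 0 < normc (twopii R) by rewrite normc_gt0 twopii_neq0.
have [N2 h2] := goursat z (twopii R) (derivable_holo_expC hf) 0 (mulr_gt0 t0 e2).
exists (maxn N1 N2) => N; rewrite geq_max => /andP[/h1 {}h1 /h2].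
rewrite /contour_sum !add0r (addrC (twopii R) z).
have -> : dyadic_mean N (fun z => f (expC z)) (twopii R) (z + twopii R) =
    dyadic_mean N (fun z => f (expC z)) 0 z.
  rewrite -[X in dyadic_mean _ _ X _ = _](add0r (twopii R)) dyadic_mean_shift.
  by apply: eq_dyadic_mean => w; rewrite expCD expC_twopii mulr1.
rewrite subrr mulr0 add0r normcM ler_pM2l // => h3.
set m := circle_mean f in h1 *; set D := dyadic_mean _ _ z _ in h3 *.
rewrite (_ : D - m = (D - dyadic_mean N (fun z => f (expC z)) 0 (twopii R))
   + (dyadic_mean N (fun z => f (expC z)) 0 (twopii R) - m)); last by rewrite addrA subrK.
by apply: le_trans (le_normcD _ _) _; lra.
Qed.

Lemma circle_mean_scale f w : holo f -> w != 0 ->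
  circle_mean (fun x => f (w * x)) = circle_mean f.
Proof.
move=> hf w0; have [z hz] := expC_surj w0.
apply: circle_meanE; have := circle_mean_cvg z hf.
rewrite (_ : (fun N => _) = fun N => dyadic_mean N (fun z => f (w * expC z)) 0 (twopii R)) //.
apply: funext => N.
rewrite -[X in dyadic_mean _ _ X _](add0r z) (addrC z (twopii R)) dyadic_mean_shift.
by apply: eq_dyadic_mean => y; rewrite addrC expCD hz.
Qed.

Lemma circle_mean_cst c : circle_mean (fun=> c) = c.
Proof.
apply: circle_meanE; apply/cvgCP => e e0; exists 0%N => N _.
by rewrite dyadic_mean_cst subrr normc0 ltW.
Qed.

Lemma circle_meanD f g : holo f -> holo g ->
  circle_mean (fun x => f x + g x) = circle_mean f + circle_mean g.
Proof.
move=> hf hg; apply: circle_meanE.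
rewrite (_ : (fun N => _) = (fun N => dyadic_mean N (fun z => f (expC z)) 0 (twopii R)
    + dyadic_mean N (fun z => g (expC z)) 0 (twopii R))).
  exact: cvgD (circle_mean_cvg0 hf) (circle_mean_cvg0 hg).
by apply: funext => N; rewrite dyadic_meanD.
Qed.

Lemma circle_meanZ c g : holo g ->
  circle_mean (fun x => c * g x) = c * circle_mean g.
Proof.
move=> hg; apply: circle_meanE.
rewrite (_ : (fun N => _) = (fun N => c * dyadic_mean N (fun z => g (expC z)) 0 (twopii R))).
  exact: cvgM (cvg_cst (c : C^o)) (circle_mean_cvg0 hg).
by apply: funext => N; rewrite dyadic_meanZ.
Qed.

End CircleMean.

(** * Vanishing Laurent coefficients *)

Section UniquenessFromCoefficients.
Variable R : realType.
Local Notation C := R[i].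
Local Notation holo := (@holomorphic_on_punctured_plane R).
Implicit Types (f g : C -> C).

Lemma normc_expC_imaginary (z : C) : complex.Re z = 0 -> normc (expC z) = 1.
Proof.
move=> h; rewrite /expC h expR0 normcM normc_real normr1 mul1r /=.
by rewrite cos2Dsin2 sqrtr1.
Qed.

Lemma circle_mean_le f psi : holo f -> holo psi ->
  (forall x, normc x = 1 -> `|f x| <= psi x) ->
  normc (circle_mean f) <= normc (circle_mean psi).
Proof.
move=> hf hp h; apply/ler_addgt0Pr => e e0.
have e2 : 0 < e / 2 by rewrite divr_gt0.
have [N1 h1] := (cvgCP _ _).1 (circle_mean_cvg0 hf) _ e2.
have [N2 h2] := (cvgCP _ _).1 (circle_mean_cvg0 hp) _ e2.
pose N := maxn N1 N2.
move: {h1 h2} (h1 N (leq_maxl _ _)) (h2 N (leq_maxr _ _)).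
set A := dyadic_mean _ _ _ _; set B := dyadic_mean _ _ _ _ => h1 h2.
have hAB : `|A| <= B.
  apply: (@dyadic_mean_le _ (fun z => complex.Re z = 0)) => //.
  - move=> z w; rewrite (_ : (z + w) / 2 = (2^-1)%:C * (z + w)); last first.
      by rewrite fmorphV rmorph_nat mulrC.
    by case: z w => [a b] [c d] /= -> ->; rewrite addr0 mul0r mulr0 subr0.
  - by move=> z /normc_expC_imaginary; exact: h.
have hB : normc A <= normc B.
  by rewrite -lecR -!normCE [X in _ <= X]ger0_norm // (le_trans _ hAB).
have k1 := le_normcD A (circle_mean f - A); rewrite addrC subrK normc_distC in k1.
have k2 := le_normcD (circle_mean psi) (B - circle_mean psi).
rewrite (addrC (circle_mean psi)) subrK in k2.
lra.
Qed.

(** Scaling by 2 multiplies the mean by [2 ^ k] and leaves it unchanged. *)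
Lemma circle_meanXz (k : int) : circle_mean (fun x : C => x ^ k) = (k == 0)%:R.
Proof.
have [->|k0] := eqVneq k 0; first exact: circle_mean_cst.
have two0 : (2 : C) != 0 by rewrite pnatr_eq0.
have := circle_mean_scale (@holoXz R k) two0.
have -> : (fun x : C => (2 * x) ^ k) = fun x => 2 ^ k * x ^ k.
  apply: funext => x; have [->|x0] := eqVneq x 0.
    by rewrite mulr0 exp0rz (negbTE k0) mulr0.
  by rewrite exprzMl // unitfE.
rewrite circle_meanZ; last exact: holoXz.
move/eqP; rewrite -subr_eq0 -[X in _ - X]mul1r -mulrBl mulf_eq0 subr_eq0 => /orP[|/eqP //].
by rewrite pexprz_eq1 // (negbTE k0) /= -subr_eq0 (_ : 2 - 1 = 1) ?oner_eq0 //; ring.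
Qed.

Lemma holo_bounded_on_circle f : holo f -> exists B : R,
  forall x, normc x = 1 -> normc (f x) <= B.
Proof.
move=> hf; pose h n : C := (2^-1) ^+ n.
pose T z n := exists B : R, forall s : R, 0 <= s <= 1 ->
  normc (f (expC (z + h n * (s%:C * twopii R)))) <= B.
suff : T (0 +i* (- pi)) 0%N.
  move=> [B hB]; exists B => x hx.
  have [t tpi [ct st]] : exists2 t, `|t| <= pi & cos t = complex.Re x /\ sin t = complex.Im x.
    apply: unit_circle_angle; case: x hx => a b /= h1.
    by rewrite -[LHS]sqr_sqrtr ?addr_ge0 ?sqr_ge0 // h1 expr1n.
  have pi0 := pi_gt0 R.
  have := hB ((t + pi) / (pi *+ 2)).
  rewrite /h expr0 mul1r (_ : _ + _ = 0 +i* t); last first.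
    rewrite /twopii; move: (pi : R) pi0 => q q0; simpc; congr (_ +i* _).
    by field; rewrite gt_eqF.
  rewrite /expC /= expR0 ct st mul1r.
  rewrite (_ : _ +i* _ = x); last by case: (x).
  apply; move: tpi; rewrite ler_norml => /andP[h1 h2].
  have pp : 0 < pi *+ 2 :> R by rewrite mulrn_wgt0.
  rewrite divr_ge0 ?ler_pdivrMr ?(ltW pp) //; last lra.
  by rewrite mul1r mulr2n; lra.
apply: (@bisection _ [:: 0; twopii R] (normc (twopii R))).
- by move=> d; rewrite !inE => /orP[] /eqP->; rewrite ?normc0 ?normc_ge0.
- move=> y n hT.
  have [B1 h1] := hT 0 (mem_head _ _).
  have [|B2 h2] := hT (twopii R); first by rewrite !inE eqxx orbT.
  exists (Num.max B1 B2) => s /andP[s0 s1]; rewrite le_max; apply/orP.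
  have [s2|s2] := leP s 2^-1; [left|right].
    have -> : y + h n * (s%:C * twopii R) =
        y + (2^-1) ^+ n.+1 * 0 + h n.+1 * ((2 * s)%:C * twopii R).
      have -> : (2 * s)%:C = 2 * s%:C :> C by simpc.
      by rewrite /h exprSr; field.
    apply: h1; rewrite mulr_ge0 //=; lra.
  have -> : y + h n * (s%:C * twopii R) =
      y + (2^-1) ^+ n.+1 * twopii R + h n.+1 * ((2 * s - 1)%:C * twopii R).
    have -> : (2 * s - 1)%:C = 2 * s%:C - 1 :> C by simpc.
    by rewrite /h exprSr; field.
  by apply: h2; apply/andP; split; lra.
move=> z0; have [d d0 hd] := derivable_near (@derivable_holo_expC R f hf z0) ltr01.
set P := normc (twopii R); have P0 : 0 <= P by exact: normc_ge0.
have B1 : 0 < 2 * P + 1 by lra.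
exists (d / (2 * P + 1)); first exact: divr_gt0.
move=> y n hy hn; exists (normc (f (expC z0)) + 1) => s /andP[s0 s1].
set q := (2^-1 : R) ^+ n in hy hn.
have q0 : 0 < q by rewrite exprn_gt0.
have rd : 2 * (q * P) <= d.
  move: hn; rewrite ler_pdivlMr // => hn; apply: le_trans hn; lra.
set z := y + _.
have hz : normc (z - z0) <= d.
  apply: le_trans rd; rewrite /z addrAC; apply: le_trans (le_normcD _ _) _.
  rewrite mulr_natl mulr2n lerD // !normcM half_pow_normc normc_real ger0_norm //.
  by rewrite -/q -/P ler_pM2l // ler_piMl.
rewrite (_ : f (expC z) = f (expC z0) + (f (expC z) - f (expC z0))); last by ring.
by apply: le_trans (le_normcD _ _) _; rewrite lerD2l hd.
Qed.

Lemma central_bin_lower n : (4 ^ n <= n.*2.+1 * 'C(n.*2, n))%N.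
Proof.
elim: n => [|n IH]; first by rewrite bin0.
have e1 : (n.*2.+1 * 'C(n.*2, n) = n.+1 * 'C(n.*2.+1, n.+1))%N.
  exact: (mul_bin_diag n.*2.+1 n).
have e2 : 'C(n.*2.+1, n.+1) = 'C(n.*2.+1, n).
  rewrite -bin_sub; last by rewrite ltnS -addnn leq_addr.
  by congr 'C(_, _); rewrite -addnn -addnS addnK.
have e3 : 'C(n.+1.*2, n.+1) = (2 * 'C(n.*2.+1, n.+1))%N.
  by rewrite doubleS binS -e2 addnn -mul2n.
rewrite e3 expnS.
have : (2 * 4 ^ n <= 2 * (n.+1 * 'C(n.*2.+1, n.+1)))%N by rewrite leq_mul2l -e1.
move: (4 ^ n)%N 'C(_, _) => x y; rewrite leq_pmul2l // => h.
apply: leq_trans (_ : 4 * (n.+1 * y) <= _)%N; first by rewrite leq_mul2l h.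
by rewrite !mulnA leq_mul2r; apply/orP; right; lia.
Qed.

Lemma linear_geometric_vanish (q A : R) : 0 <= q < 1 -> forall e, 0 < e ->
  exists n : nat, A * (n.*2.+1)%:R * q ^+ n <= e.
Proof.
move=> /andP[q0 q1] e e0.
(* As q <= s ^ 2, one factor s ^ n can absorb the linear growth. *)
pose s := (1 + q) / 2.
have s0 : 0 < s by rewrite /s; lra.
have s1 : s < 1 by rewrite /s; lra.
have qs : q <= s ^+ 2 by rewrite /s; nra.
have lin n : n%:R * s ^+ n * (1 - s) <= 1 - s ^+ n.
  elim: n => [|n IH]; first by rewrite mul0r mul0r expr0 subrr.
  rewrite -natr1 exprS.
  have := ler_wpM2l (ltW s0) IH.
  have : 0 <= s ^+ n by rewrite exprn_ge0 // ltW.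
  have : s ^+ n <= 1 by rewrite exprn_ile1 // ltW.
  set y := s ^+ n; set m : R := n%:R; move=> y1 y0 h.
  have sy : 0 <= (1 - s) * (1 - s * y) by rewrite mulr_ge0 // subr_ge0 ?(ltW s1) // mulr_ile1 // ltW.
  lra.
pose M := `|A| * (2 / (1 - s) + 1).
have t0 : 0 < 1 - s by lra.
have M0 : 0 <= M by rewrite mulr_ge0 // addr_ge0 // divr_ge0 // ltW.
have M1 : 0 < M + 1 by lra.
have s01 : 0 <= s < 1 by rewrite ltW.
have [n hn] := small_power s01 (divr_gt0 e0 M1).
exists n.
have sn0 : 0 <= s ^+ n by rewrite exprn_ge0 // ltW.
have k1 : (n.*2.+1)%:R * s ^+ n <= 2 / (1 - s) + 1.
  have : n%:R * s ^+ n <= (1 - s)^-1.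
    rewrite -[X in _ <= X]mul1r ler_pdivlMr //.
    by apply: le_trans (lin n) _; rewrite gerBl.
  have : s ^+ n <= 1 by rewrite exprn_ile1 // ltW.
  rewrite -natr1 -mul2n natrM; lra.
have k2 : q ^+ n <= s ^+ n * s ^+ n.
  by rewrite -expr2 exprAC; apply: lerXn2r => //; rewrite nnegrE ?exprn_ge0 // ltW.
apply: le_trans (ler_norm _) _.
rewrite !normrM (ger0_norm (ler0n _ _)) (ger0_norm (exprn_ge0 _ q0)).
apply: le_trans (ler_wpM2l _ k2) _; first by rewrite mulr_ge0.
rewrite -!mulrA (mulrA (n.*2.+1)%:R).
have k3 : `|A| * ((n.*2.+1)%:R * s ^+ n * s ^+ n) <= M * s ^+ n.
  by rewrite /M -(mulrA `|A|) ler_wpM2l // ler_wpM2r.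
apply: le_trans k3 _; move: hn; rewrite ler_pdivlMr // => hn.
by apply: le_trans hn; rewrite mulrC ler_wpM2l // lerDl.
Qed.

(** On the unit circle, with [x = exp(i t)], this is [(2 + 2 cos t) ^ n]. *)
Definition cos_kernel n (x : C) : C := (x^-1 * (1 + x) ^+ 2) ^+ n.

Lemma holo_cos_kernel n : holo (cos_kernel n).
Proof.
have h1 : holo (fun x : C => x^-1) := holoV (f := id) (fun x x0 => x0) (@holo_id R).
have h2 : holo (fun x : C => (1 + x) ^+ 2) 
  := @holoX R _ 2 (holoD (@holo_cst R 1) (@holo_id R)).
exact: (@holoX R _ n (holoM h1 h2)).
Qed.

Lemma circle_mean_sum (I : Type) (r : seq I) (F : I -> C -> C) :
  (forall i, holo (F i)) ->
  circle_mean (fun x => \sum_(i <- r) F i x) = \sum_(i <- r) circle_mean (F i).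
Proof.
move=> h; elim: r => [|i r IH].
  rewrite big_nil -[RHS](circle_mean_cst (0 : C)); congr circle_mean.
  by apply: funext => x; rewrite big_nil.
rewrite big_cons -IH -circle_meanD //; last exact: holo_sum.
by congr circle_mean; apply: funext => x; rewrite big_cons.
Qed.

Lemma eq_circle_mean f g : (forall x, x != 0 -> f x = g x) ->
  circle_mean f = circle_mean g.
Proof.
move=> h; rewrite /circle_mean; do 2!f_equal; apply: funext => N.
by apply: eq_dyadic_mean => z; rewrite h // expC_neq0.
Qed.

Lemma circle_mean_cos_kernel n g : holo g ->
  circle_mean (fun x => cos_kernel n x * g x) =
  \sum_(j < n.*2.+1) ('C(n.*2, j))%:R * circle_mean (fun x => x ^ (j%:Z - n%:Z) * g x).
Proof.
move=> hg.
have hj (j : 'I_n.*2.+1) : holo (fun x => x ^ (j%:Z - n%:Z) * g x).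
  exact: holoM (@holoXz R _) hg.
pose F (j : 'I_n.*2.+1) (x : C) := ('C(n.*2, j))%:R * (x ^ (j%:Z - n%:Z) * g x).
transitivity (\sum_(j < n.*2.+1) circle_mean (F j)); last first.
  by apply: eq_bigr => j _; exact: circle_meanZ (hj j).
rewrite -circle_mean_sum; last first.
  by move=> j; exact: holoM (@holo_cst R _) (hj j).
apply: eq_circle_mean => x x0.
rewrite /cos_kernel exprMn -exprM mul2n exprVn exprDn mulr_sumr mulr_suml.
apply: eq_bigr => j _; rewrite /F expr1n mul1r expfzDr // -invr_expz -!exprnP.
by rewrite -mulr_natl; ring.
Qed.

Lemma cos_kernel_circle n x : normc x = 1 ->
  cos_kernel n x = ((4 - normc (x - 1) ^+ 2) ^+ n)%:C /\
  0 <= 4 - normc (x - 1) ^+ 2.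
Proof.
case: x => a b /= hx.
have hab : a ^+ 2 + b ^+ 2 = 1.
  by rewrite -[LHS]sqr_sqrtr ?addr_ge0 ?sqr_ge0 // hx expr1n.
rewrite (sqr_sqrtr (addr_ge0 (sqr_ge0 _) (sqr_ge0 _))) subr0.
split; last by nra.
rewrite /cos_kernel rmorphXn; congr (_ ^+ n).
have ab1 : (a +i* b) * (a -i* b) = 1 :> C.
  by simpc; apply/eqP; rewrite eq_complex /=; apply/andP; split; apply/eqP; lra.
have nz : a +i* b != 0 :> C.
  by apply/eqP => z0; move/eqP: ab1; rewrite z0 mul0r eq_sym oner_eq0.
have -> : (a +i* b)^-1 = a -i* b by rewrite -[LHS]mulr1 -ab1 mulKf.
rewrite (_ : _ * _ = (a -i* b) + 2 * ((a +i* b) * (a -i* b))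
  + ((a +i* b) * (a -i* b)) * (a +i* b)); last by ring.
rewrite ab1 mulr1 mul1r; apply/eqP; rewrite eq_complex /=.
by apply/andP; split; apply/eqP; lra.
Qed.

(** The kernels [(2 + x + 1/x) ^ n] are Laurent polynomials, so their products
    with [f] have mean zero. On the unit circle they are nonnegative, and their
    mass, which is [C(2n, n)] and so at least [4 ^ n / (2n + 1)], concentrates
    at 1. Hence [f] vanishes at 1, and by scaling everywhere. *)
Lemma holo_eq0 f : holo f ->
  (forall k : int, circle_mean (fun x => x ^ k * f x) = 0) ->
  forall w, w != 0 -> f w = 0.
Proof.
move=> hf h0 w w0; pose g x := f (w * x).
have hg : holo g by exact: holo_scale.
have g0 (k : int) : circle_mean (fun x => x ^ k * g x) = 0.
  have hk : holo (fun x => x ^ k * f x) by exact: holoM (@holoXz R k) hf.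
  have := circle_mean_scale hk w0; rewrite h0.
  rewrite (@eq_circle_mean _ (fun x => w ^ k * (x ^ k * g x))); last first.
    by move=> x x0; rewrite exprzMl ?unitfE // mulrA.
  rewrite circle_meanZ; last exact: holoM (@holoXz R k) hg.
  by move/eqP; rewrite mulf_eq0 (negbTE (expfz_neq0 _ _)) //= => /eqP.
suff : g 1 = 0 by rewrite /g mulr1.
apply/eqP; rewrite -normc_eq0 eq_le normc_ge0 andbT.
apply/ler_addgt0Pr => e e0; rewrite add0r.
have [B hB] := holo_bounded_on_circle hg.
have n1 : normc (1 : C) = 1 by exact: normc1.
have B0 : 0 <= B by apply: le_trans (normc_ge0 _) (hB _ n1).
have e4 : 0 < e / 2 by rewrite divr_gt0.
have [d d0 hd] := derivable_near (hg 1 (oner_neq0 _)) e4.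
pose r := Num.min d 1.
have r0 : 0 < r by rewrite lt_min d0 ltr01.
have near1 x : normc (x - 1) <= r -> normc (g x - g 1) <= e / 2.
  by rewrite le_min => /andP[/hd].
pose q := (4 - r ^+ 2) / 4.
have r1 : r <= 1 by rewrite ge_min lexx orbT.
have q01 : 0 <= q < 1 by rewrite /q; apply/andP; split; nra.
have [n hn] := linear_geometric_vanish (2 * B) q01 e4.
pose M := 2 * B * (4 * q) ^+ n.
have M0 : 0 <= M.
  by rewrite !mulr_ge0 // exprn_ge0 // mulr_ge0 //; case/andP: q01.
have hK := @holo_cos_kernel n.
have hG : holo (fun x => g x - g 1) by exact: holoB hg (@holo_cst R (g 1)).
have hpsi : holo (fun x => (e / 2)%:C * cos_kernel n x + M%:C).
  exact: holoD (holoM (@holo_cst R _) hK) (@holo_cst R _).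
have := @circle_mean_le (fun x => cos_kernel n x * (g x - g 1)) _ (holoM hK hG) hpsi.
have LK : circle_mean (cos_kernel n) = ('C(n.*2, n))%:R.
  rewrite (@eq_circle_mean _ (fun x => cos_kernel n x * 1)) => [|x _]; last by rewrite mulr1.
  rewrite (circle_mean_cos_kernel n (@holo_cst R 1)).
  have nlt : (n < n.*2.+1)%N by rewrite ltnS -addnn leq_addr.
  rewrite (bigD1 (Ordinal nlt)) //= big1 => [|j jn].
    rewrite subrr (@eq_circle_mean _ (fun=> 1)) ?circle_mean_cst ?mulr1 ?addr0 // => x _.
    by rewrite expr0z mulr1.
  rewrite (@eq_circle_mean _ (fun x => x ^ (j%:Z - n%:Z))) => [|x _]; last by rewrite mulr1.
  rewrite circle_meanXz subr_eq0 eqz_nat (_ : (j == n :> nat) = false) ?mulr0 //.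
  by apply: contraNF jn => /eqP e1; apply/eqP/val_inj.
have -> : circle_mean (fun x => cos_kernel n x * (g x - g 1)) = - g 1 * ('C(n.*2, n))%:R.
  rewrite (@eq_circle_mean _ (fun x => cos_kernel n x * g x + - g 1 * cos_kernel n x)).
    rewrite circle_meanD; [|exact: holoM hK hg|exact: holoM (@holo_cst R _) hK].
    rewrite circle_meanZ // LK circle_mean_cos_kernel // big1 ?add0r // => j _.
    by rewrite g0 mulr0.
  by move=> x _; ring.
rewrite circle_meanD; [|exact: holoM (@holo_cst R _) hK|exact: holo_cst].
rewrite circle_meanZ // LK circle_mean_cst => hle.
have {}hle : normc (- g 1 * ('C(n.*2, n))%:R) <= normc ((e / 2)%:C * ('C(n.*2, n))%:R + M%:C).
  apply: hle => x hx; have [-> K0] := cos_kernel_circle n hx.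
  set y := _ ^+ n; have y0 : 0 <= y by rewrite exprn_ge0.
  rewrite -rmorphM -rmorphD normCE lecR normcM normc_real (ger0_norm y0).
  have [hr|hr] := leP (normc (x - 1)) r.
    by rewrite ler_wpDr // mulrC ler_wpM2r // near1.
  apply: ler_wpDl; first by rewrite mulr_ge0 // ltW.
  rewrite mulrC /M; apply: ler_pM => //; first exact: normc_ge0.
    apply: le_trans (le_normcD _ _) _; rewrite normcN.
    by have := hB _ hx; have := hB _ n1; lra.
  rewrite /y lerXn2r ?nnegrE // /q; first by rewrite mulr_ge0 //; case/andP: q01.
  by nra.
move: hle; rewrite -(rmorph_nat (real_complex R)) -rmorphM -rmorphD.
rewrite normcM normcN !normc_real (ger0_norm (ler0n _ _)) ger0_norm; last first.
  by rewrite addr_ge0 // mulr_ge0 // ltW.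
have cb : (4 : R) ^+ n <= (n.*2.+1)%:R * ('C(n.*2, n))%:R.
  by rewrite -natrX -natrM ler_nat central_bin_lower.
have c0 : 0 < ('C(n.*2, n))%:R :> R by rewrite ltr0n bin_gt0 -addnn leq_addr.
set c : R := _%:R in c0 cb *.
have Mle : M <= e / 2 * c.
  rewrite /M exprMn; have := ler_wpM2r (ltW c0) hn.
  have qn : 0 <= q ^+ n by rewrite exprn_ge0 //; case/andP: q01.
  have := ler_wpM2l (mulr_ge0 (mulr_ge0 (ler0n R 2) B0) qn) cb.
  lra.
by move=> h; rewrite -(ler_pM2r c0); lra.
Qed.

End UniquenessFromCoefficients.

(** * The theta function *)

Section Theta.
Variable R : realType.
Local Notation C := R[i].
Local Notation holo := (@holomorphic_on_punctured_plane R).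
Variable p : C.
Hypothesis hp : 0 < `|p| < 1.
Local Notation rho := (normc p).

Lemma nome_neq0 : p != 0.
Proof. by case/andP: hp; rewrite normr_gt0. Qed.

Lemma nome_modulus : 0 < rho < 1.
Proof. by move: hp; rewrite normCE !ltcR. Qed.

Lemma geometric_sum_le N : \sum_(0 <= j < N) rho ^+ j <= (1 - rho)^-1.
Proof.
have /andP[r0 r1] := nome_modulus.
have t0 : 0 < 1 - rho by lra.
rewrite -[X in _ <= X]mul1r ler_pdivlMr // mulrC big_mkord -opprB mulNr -subrX1 opprB.
by rewrite gerBl exprn_ge0 // ltW.
Qed.

(** A discrete Gronwall inequality: the products of the factors
    [1 + A rho ^ j] stay bounded. It yields every estimate on partial products
    that is uniform in the number of factors. *)
Lemma perturbed_recursion_bound (u : nat -> R) (A B : R) : 0 <= A -> 0 <= B -> 0 <= u 0%N ->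
  (forall N, u N.+1 <= u N * (1 + A * rho ^+ N) + B * rho ^+ N) ->
  forall N, u N <= expR (A / (1 - rho)) * (u 0%N + B / (1 - rho)).
Proof.
move=> A0 B0 u0 h N; have /andP[r0 r1] := nome_modulus.
have rn j : 0 <= rho ^+ j by rewrite exprn_ge0 // ltW.
pose w N := \prod_(0 <= j < N) (1 + A * rho ^+ j).
have w1 M : 1 <= w M.
  rewrite /w; elim: M => [|M IH]; first by rewrite big_nil.
  by rewrite big_nat_recr //= mulr_ege1 // lerDl mulr_ge0.
have wE M : w M <= expR (A / (1 - rho)).
  apply: le_trans (_ : expR (A * \sum_(0 <= j < M) rho ^+ j) <= _).
    rewrite mulr_sumr expR_sum /w; apply: ler_prod => j _.
    by rewrite expR_ge1Dx addr_ge0 // mulr_ge0.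
  by rewrite ler_expR ler_wpM2l // geometric_sum_le.
have uw M : u M <= w M * (u 0%N + B * \sum_(0 <= j < M) rho ^+ j).
  elim: M => [|M IH]; first by rewrite /w !big_nil mul1r mulr0 addr0.
  apply: le_trans (h M) _.
  have k0 : 0 <= 1 + A * rho ^+ M by rewrite addr_ge0 // mulr_ge0.
  have := ler_wpM2r k0 IH.
  rewrite /w !big_nat_recr //= -/(w M); set s := \sum_(_ <= _ < _) _; set v := rho ^+ M.
  have : B * v <= w M * (1 + A * v) * (B * v).
    have v0 : 0 <= v by exact: rn.
    by rewrite ler_peMl ?(mulr_ge0 B0) // mulr_ege1 ?w1 // lerDl mulr_ge0.
  by lra.
apply: le_trans (uw N) _; apply: ler_pM => //.
- exact: le_trans (w1 N).
- by rewrite addr_ge0 // mulr_ge0 // sumr_ge0.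
- by rewrite lerD2l ler_wpM2l // geometric_sum_le.
Qed.

Lemma geometric_increments_cvg (v : nat -> C) (B : R) : 0 <= B ->
  (forall N, normc (v N.+1 - v N) <= B * rho ^+ N) ->
  exists l : C, (v : nat -> C^o) @ \oo --> (l : C^o).
Proof.
move=> B0 h; have /andP[r0 r1] := nome_modulus.
have rn j : 0 <= rho ^+ j by rewrite exprn_ge0 // ltW.
have t0 : 0 < 1 - rho by lra.
have step N k : normc (v (N + k)%N - v N) <= B * rho ^+ N * \sum_(0 <= j < k) rho ^+ j.
  elim: k => [|k IH]; first by rewrite addn0 subrr normc0 big_nil mulr0.
  rewrite addnS (_ : _ - _ = (v (N + k)%N - v N) + (v (N + k).+1 - v (N + k)%N)); last by ring.
  apply: le_trans (le_normcD _ _) _; rewrite big_nat_recr //= mulrDr.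
  by apply: lerD => //; apply: le_trans (h _) _; rewrite exprD mulrA.
have step' N k : (N <= k)%N -> normc (v k - v N) <= B / (1 - rho) * rho ^+ N.
  move=> /subnKC <-; apply: le_trans (step _ _) _.
  by rewrite (mulrAC B (1 - rho)^-1) ler_wpM2l ?mulr_ge0 // geometric_sum_le.
apply: cauchyC => e e0.
pose M := B / (1 - rho) + B / (1 - rho) + 1.
have M0 : 0 <= B / (1 - rho) by rewrite divr_ge0 // ltW.
have M1 : 0 < M by rewrite /M; lra.
have rho01 : 0 <= rho < 1 by rewrite ltW.
have [n hn] := small_power rho01 (divr_gt0 e0 M1).
exists n => j k hj hk.
rewrite (_ : v j - v k = (v j - v n) + (v n - v k)); last by ring.
apply: le_trans (le_normcD _ _) _; rewrite (normc_distC (v n)).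
apply: le_trans (lerD (step' _ _ hj) (step' _ _ hk)) _.
move: hn; rewrite ler_pdivlMr // => hn; apply: le_trans hn.
by rewrite -mulrDl mulrC ler_wpM2l // lerDl.
Qed.

Definition qpoch_partial (N : nat) (a : C) : C := \prod_(0 <= j < N) (1 - a * p ^+ j).

Lemma qpoch_partialS N a :
  qpoch_partial N.+1 a = qpoch_partial N a * (1 - a * p ^+ N).
Proof. by rewrite /qpoch_partial big_nat_recr. Qed.

Lemma normc_factor_le (a : C) (A : R) N : normc a <= A ->
  normc (1 - a * p ^+ N) <= 1 + A * rho ^+ N.
Proof.
move=> hA; have /andP[r0 r1] := nome_modulus.
apply: le_trans (le_normcD _ _) _; rewrite normcN normcM normcX normc1 lerD2l.
by rewrite ler_wpM2r // exprn_ge0 // ltW.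
Qed.

Lemma qpoch_partial_bound (A : R) : 0 <= A -> exists2 E : R, 0 <= E &
  forall a N, normc a <= A -> normc (qpoch_partial N a) <= E.
Proof.
move=> A0; exists (expR (A / (1 - rho))); first exact: expR_ge0.
move=> a N hA.
have := @perturbed_recursion_bound (fun N => normc (qpoch_partial N a)) A 0 A0 (lexx _) (normc_ge0 _).
rewrite mul0r addr0 /qpoch_partial !big_nil normc1 mulr1; apply => M.
rewrite -/(qpoch_partial _ _) mul0r addr0 qpoch_partialS normcM.
by rewrite ler_wpM2l ?normc_ge0 // normc_factor_le.
Qed.

Lemma qpoch_cvg a : (fun N => qpoch_partial N a : C^o) @ \oo --> (qpoch a p : C^o).
Proof.
have [E E0 hE] := qpoch_partial_bound (normc_ge0 a).
suff [l hl] : exists l : C, (fun N => qpoch_partial N a : C^o) @ \oo --> (l : C^o).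
  by apply/cvg_ex; exists l.
apply: (@geometric_increments_cvg _ (E * normc a)) => [|N].
  by rewrite mulr_ge0 ?normc_ge0.
rewrite qpoch_partialS (_ : _ - _ = - (qpoch_partial N a * a * p ^+ N)); last by ring.
rewrite normcN !normcM normcX -!mulrA ler_wpM2r ?mulr_ge0 ?normc_ge0 ?exprn_ge0 ?normc_ge0 //.
exact: hE.
Qed.

Lemma qpochE a (l : C) : (fun N => qpoch_partial N a : C^o) @ \oo --> (l : C^o) ->
  qpoch a p = l.
Proof. exact: (@cvg_lim C^o (@norm_hausdorff _ _)). Qed.

(** Partial products satisfy a second order Taylor estimate that is uniform in
    the number of factors, so differentiability survives in the limit. *)
Lemma derivable_qpoch a : derivable ((fun x => qpoch x p) : C^o -> C^o) a 1.
Proof.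
have /andP[r0 r1] := nome_modulus.
have rn j : 0 <= rho ^+ j by rewrite exprn_ge0 // ltW.
have t0 : 0 < 1 - rho by lra.
pose A := normc a + 1.
have A0 : 0 <= A by rewrite addr_ge0 ?normc_ge0.
have aA : normc a <= A by rewrite lerDl.
have [E E0 hE] := qpoch_partial_bound A0.
pose W := expR (A / (1 - rho)); pose S := (1 - rho)^-1.
have W0 : 0 <= W by exact: expR_ge0.
have S0 : 0 <= S by rewrite invr_ge0 ltW.
(* The derivatives at a of the partial products. *)
pose D := fix D N := if N is M.+1 then D M * (1 - a * p ^+ M) - p ^+ M * qpoch_partial M a else 0.
have bD N : normc (D N) <= W * (E * S).
  have := @perturbed_recursion_bound (fun N => normc (D N)) A E A0 E0 (normc_ge0 _).
  rewrite (_ : D 0%N = 0) // normc0 add0r; apply => M; rewrite [D M.+1]/=.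
  apply: le_trans (le_normcD _ _) _; rewrite normcN !normcM normcX; apply: lerD.
    by rewrite ler_wpM2l ?normc_ge0 // normc_factor_le.
  by rewrite mulrC ler_wpM2r // hE.
have [l hl] : exists l : C, (D : nat -> C^o) @ \oo --> (l : C^o).
  apply: (@geometric_increments_cvg _ (W * (E * S) * A + E)) => [|N].
    by rewrite addr_ge0 // !mulr_ge0.
  rewrite /= (_ : _ - _ = - (D N * a * p ^+ N + p ^+ N * qpoch_partial N a)); last by ring.
  rewrite normcN; apply: le_trans (le_normcD _ _) _; rewrite !normcM normcX mulrDl.
  apply: lerD; last by rewrite mulrC ler_wpM2r // hE.
  by rewrite ler_wpM2r //; apply: ler_pM; rewrite ?normc_ge0.
apply/derivableCP; exists l => e e0.
pose K := W * (W * (E * S) * S).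
have K0 : 0 <= K by rewrite /K !mulr_ge0.
have K1 : 0 < K + 1 by lra.
exists (Num.min 1 (e / (K + 1))); first by rewrite lt_min ltr01 divr_gt0.
move=> h; rewrite le_min => /andP[h1 h2].
have hA : normc (a + h) <= A by apply: le_trans (le_normcD _ _) _; rewrite lerD2l.
have bDelta N : normc (qpoch_partial N (a + h) - qpoch_partial N a) <= W * (E * S) * normc h.
  have Eh : 0 <= E * normc h by rewrite mulr_ge0 ?normc_ge0.
  have := @perturbed_recursion_bound
    (fun N => normc (qpoch_partial N (a + h) - qpoch_partial N a)) A _ A0 Eh (normc_ge0 _).
  rewrite /qpoch_partial !big_nil subrr normc0 add0r -/S -/W => hh.
  rewrite (_ : W * (E * S) * normc h = W * (E * normc h * S)); last by ring.
  apply: hh => M; rewrite -!/(qpoch_partial _ _) !qpoch_partialS.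
  rewrite (_ : _ - _ = (qpoch_partial M (a + h) - qpoch_partial M a) * (1 - (a + h) * p ^+ M)
    - qpoch_partial M a * h * p ^+ M); last by ring.
  apply: le_trans (le_normcD _ _) _; rewrite normcN !normcM normcX; apply: lerD.
    by rewrite ler_wpM2l ?normc_ge0 // normc_factor_le.
  by rewrite ler_wpM2r // ler_wpM2r ?normc_ge0 // hE.
have brem N : normc (qpoch_partial N (a + h) - qpoch_partial N a - D N * h) <= K * normc h ^+ 2.
  have Bh : 0 <= W * (E * S) * normc h ^+ 2 by rewrite !mulr_ge0 ?normc_ge0.
  have := @perturbed_recursion_bound
    (fun N => normc (qpoch_partial N (a + h) - qpoch_partial N a - D N * h)) A _ A0 Bh (normc_ge0 _).
  rewrite /qpoch_partial !big_nil subrr (_ : D 0%N = 0) // mul0r subrr normc0 add0r -/S -/W => hh.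
  rewrite (_ : K * _ = W * (W * (E * S) * normc h ^+ 2 * S)); last by rewrite /K; ring.
  apply: hh => M; rewrite -!/(qpoch_partial _ _) !qpoch_partialS.
  rewrite [D M.+1]/= (_ : normc _ = normc (
    (qpoch_partial M (a + h) - qpoch_partial M a - D M * h) * (1 - a * p ^+ M)
    - (qpoch_partial M (a + h) - qpoch_partial M a) * h * p ^+ M)); last by congr normc; ring.
  apply: le_trans (le_normcD _ _) _; rewrite normcN !normcM normcX; apply: lerD.
    by rewrite ler_wpM2l ?normc_ge0 // normc_factor_le.
  by rewrite ler_wpM2r // expr2 (mulrA _ (normc h)) ler_wpM2r ?normc_ge0.
have : normc (qpoch (a + h) p - qpoch a p - l * h) <= K * normc h ^+ 2.
  apply/ler_addgt0Pr => e1 e10.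
  have h3 := cvgB (cvgB (@qpoch_cvg (a + h)) (@qpoch_cvg a)) (cvgM hl (cvg_cst (h : C^o))).
  have [N /(_ N (leqnn N)) hN] := (cvgCP _ _).1 (h3 _ _ _ _) e1 e10.
  have hN' : normc (qpoch_partial N (a + h) - qpoch_partial N a - D N * h -
    (qpoch (a + h) p - qpoch a p - l * h)) <= e1 by exact: hN.
  rewrite normc_distC in hN'.
  have := le_normcD (qpoch (a + h) p - qpoch a p - l * h -
    (qpoch_partial N (a + h) - qpoch_partial N a - D N * h))
    (qpoch_partial N (a + h) - qpoch_partial N a - D N * h).
  rewrite subrK => k1; apply: le_trans k1 _; rewrite addrC.
  by apply: lerD; [exact: brem|exact: hN'].
move=> k; apply: le_trans k _; rewrite expr2 mulrA ler_wpM2r ?normc_ge0 //.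
move: h2; rewrite ler_pdivlMr // => h2; apply: le_trans h2.
by rewrite mulrC ler_wpM2l ?normc_ge0 // lerDl.
Qed.

Lemma qpoch_shift a : qpoch a p = (1 - a) * qpoch (a * p) p.
Proof.
apply: qpochE; apply/cvgCP => e e0.
have hc := cvgM (cvg_cst (1 - a : C^o)) (@qpoch_cvg (a * p)).
have [N hN] := (cvgCP _ _).1 (hc _ _) e e0.
exists N.+1 => -[//|k]; rewrite ltnS => /hN.
rewrite (_ : qpoch_partial k.+1 a = (1 - a) * qpoch_partial k (a * p)) //.
rewrite /qpoch_partial big_nat_recl //= expr0 mulr1; congr (_ * _).
by apply: eq_bigr => j _; rewrite exprS mulrA.
Qed.

Lemma qpoch0 : qpoch 0 p = 1.
Proof.
apply: qpochE; apply/cvgCP => e e0; exists 0%N => k _.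
rewrite /qpoch_partial big1 ?subrr ?normc0 ?ltW // => j _.
by rewrite mul0r subr0.
Qed.

(** If no factor vanished, all the tails [qpoch (a p ^ N) p] would vanish with
    the product, but they tend to [qpoch 0 p = 1]. *)
Lemma qpoch_eq0 a : qpoch a p = 0 -> exists j : nat, a * p ^+ j = 1.
Proof.
move=> ha; apply: contrapT => hn.
have ne j : 1 - a * p ^+ j != 0.
  by rewrite subr_eq0; apply/eqP => h; apply: hn; exists j.
have shift N : qpoch (a * p ^+ N) p = 0.
  elim: N => [|N IH]; first by rewrite expr0 mulr1.
  move: IH; rewrite qpoch_shift => /eqP; rewrite mulf_eq0 (negbTE (ne N)) /= => /eqP.
  by rewrite exprSr mulrA.
have [d d0 hd] := derivable_near (@derivable_qpoch 0) (divr_gt0 ltr01 (ltr0Sn R 1)).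
have /andP[r0 r1] := nome_modulus.
have rho01 : 0 <= rho < 1 by rewrite ltW.
have M1 : 0 < normc a + 1 by rewrite ltr_wpDl ?normc_ge0.
have [n hn'] := small_power rho01 (divr_gt0 d0 M1).
have := hd (a * p ^+ n); rewrite subr0 shift qpoch0 sub0r normcN normc1.
rewrite normcM normcX => small.
suff /small : normc a * rho ^+ n <= d by lra.
move: hn'; rewrite ler_pdivlMr // => h; apply: le_trans h.
by rewrite mulrC ler_wpM2l ?exprn_ge0 ?(ltW r0) // lerDl.
Qed.

Lemma qpoch1 : qpoch 1 p = 0.
Proof. by rewrite qpoch_shift subrr mul0r. Qed.

Lemma theta_nome_div x : x != 0 -> theta p (p / x) = theta p x.
Proof.
move=> x0; have p0 := nome_neq0; rewrite /theta mulrC.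
by rewrite (_ : p / (p / x) = x) //; field; rewrite x0 p0.
Qed.

Lemma theta_nome x : x != 0 -> theta p (p * x) = - x^-1 * theta p x.
Proof.
move=> x0; have p0 := nome_neq0; have [->|x1] := eqVneq x 1.
  by rewrite mulr1 /theta !divr1 divff // qpoch1 mul0r !mulr0.
have e1 := qpoch_shift x; have e2 := qpoch_shift x^-1.
rewrite /theta (_ : p / (p * x) = x^-1); last by field; rewrite x0 p0.
have d : 1 - x != 0 by rewrite subr_eq0 eq_sym.
rewrite e1 e2 (mulrC x p) (mulrC x^-1 p); field; exact: x0.
Qed.

Lemma theta_inv x : x != 0 -> theta p x^-1 = - x^-1 * theta p x.
Proof.
move=> x0; rewrite -theta_nome // -[LHS]theta_nome_div ?invr_eq0 //.
by rewrite invrK.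
Qed.

Lemma theta1 : theta p 1 = 0.
Proof. by rewrite /theta qpoch1 mul0r. Qed.

Lemma theta_eq0 x : x != 0 -> theta p x = 0 -> exists k : int, x = p ^ k.
Proof.
move=> x0 /eqP; have p0 := nome_neq0; rewrite mulf_eq0 => /orP[] /eqP /qpoch_eq0 [j hj].
  exists (- j%:Z); rewrite -invr_expz -exprnP; apply: (mulIf (expf_neq0 j p0)).
  by rewrite hj mulVf // expf_neq0.
exists (j.+1%:Z); rewrite -exprnP exprS -[LHS]mulr1 -hj.
by field; rewrite x0.
Qed.

Lemma holo_theta : holo (theta p).
Proof.
have h1 : holo (fun x => qpoch x p) by move=> x _; exact: derivable_qpoch.
have h2 : holo (fun x => p / x).
  exact: holoM (@holo_cst R p) (holoV (f := id) (fun x x0 => x0) (@holo_id R)).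
have h0 (x : C) : x != 0 -> p / x != 0 by move=> x0; rewrite mulf_neq0 ?nome_neq0 ?invr_eq0.
by have h3 := @holo_comp R (fun x => qpoch x p) (fun x => p / x) h0 h1 h2; exact: holoM h1 h3.
Qed.

End Theta.

(** * Interpolation in finite-dimensional function spaces *)

Section Interpolation.
Variables (F : fieldType) (T : Type) (dom : T -> Prop) (n : nat).
Variables (V : (T -> F) -> Prop) (coord : (T -> F) -> 'rV[F]_n).

(** The injective linear map [coord] bounds the dimension of [V] by [n]. Members
    of [V] only matter on [dom], as theta functions are meaningless at 0. *)
Record coordinate_space : Prop := CoordinateSpace {
  space0 : V (fun=> 0);
  space_lin : forall c f g, V f -> V g -> V (fun x => c * f x + g x);
  coord_lin : forall c f g, V f -> V g ->
    coord (fun x => c * f x + g x) = c *: coord f + coord g;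
  coord_inj : forall f, V f -> coord f = 0 -> forall x, dom x -> f x = 0 }.

Hypothesis hV : coordinate_space.

Lemma coord0 : coord (fun=> 0) = 0.
Proof.
have := coord_lin hV 1 (space0 hV) (space0 hV).
rewrite (_ : (fun x => 1 * 0 + 0) = fun=> 0); last by apply: funext => x; rewrite mulr0 addr0.
by rewrite scale1r => /eqP; rewrite -subr_eq subrr eq_sym => /eqP.
Qed.

Lemma space_comb m (G : 'I_m -> T -> F) (v : 'I_m -> F) : (forall i, V (G i)) ->
  V (fun x => \sum_i v i * G i x) /\
  coord (fun x => \sum_i v i * G i x) = \sum_i v i *: coord (G i).
Proof.
move=> hG.
have key (r : seq 'I_m) : V (fun x => \sum_(i <- r) v i * G i x) /\
    coord (fun x => \sum_(i <- r) v i * G i x) = \sum_(i <- r) v i *: coord (G i).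
  elim: r => [|i r [IH1 IH2]].
    rewrite (_ : (fun x => _) = fun=> 0); last by apply: funext => x; rewrite big_nil.
    by rewrite big_nil coord0; split=> //; exact: space0.
  rewrite (_ : (fun x => _) = fun x => v i * G i x + \sum_(j <- r) v j * G j x); last first.
    by apply: funext => x; rewrite big_cons.
  by rewrite big_cons -IH2; split; [exact: space_lin|exact: coord_lin].
exact: key.
Qed.

(** Functions dual to [n] points have linearly independent coordinate vectors,
    hence these form a basis, so a member of the space is determined by its
    values at the [n] points. *)
Lemma interpolation_unique (z : 'I_n -> T) (G : 'I_n -> T -> F) (h : T -> F) :
  (forall i, dom (z i)) -> (forall i, V (G i)) ->
  (forall i j, i != j -> G i (z j) = 0) -> (forall i, G i (z i) != 0) ->
  V h -> (forall i, h (z i) = 0) -> forall x, dom x -> h x = 0.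
Proof.
move=> hz hG G0 Gn Vh h0.
pose M := \matrix_i coord (G i).
have comb v : v *m M = \sum_i v 0 i *: coord (G i).
  by rewrite mulmx_sum_row; apply: eq_bigr => i _; rewrite rowK.
have eval (v : 'I_n -> F) j : \sum_i v i * G i (z j) = v j * G j (z j).
  by rewrite (bigD1 j) //= big1 ?addr0 // => i ij; rewrite G0 // mulr0.
have Mu : M \in unitmx.
  rewrite -row_free_unit -kermx_eq0; apply/eqP/row_matrixP => i.
  rewrite row0; set v := row i _.
  have /eqP : v *m M = 0 by rewrite -row_mul mulmx_ker row0.
  rewrite comb => /eqP hv; have [V1 c1] := space_comb (v 0) hG.
  rewrite hv in c1; apply/rowP => j; rewrite [RHS]mxE.
  have /eqP := coord_inj hV V1 c1 (hz j).
  by rewrite eval mulf_eq0 (negbTE (Gn j)) orbF => /eqP.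
pose v := coord h *m invmx M.
have hv : \sum_i v 0 i *: coord (G i) = coord h by rewrite -comb mulmxKV.
have [V1 c1] := space_comb (v 0) hG.
have Vd := space_lin hV (-1) V1 Vh.
have cd := coord_lin hV (-1) V1 Vh.
rewrite c1 hv scaleN1r addNr in cd.
have hE x : dom x -> h x = \sum_i v 0 i * G i x.
  move=> dx; have /eqP := coord_inj hV Vd cd dx.
  by rewrite mulN1r addrC subr_eq0 => /eqP.
have v0 i : v 0 i = 0.
  have := hE _ (hz i); rewrite h0 eval => /esym/eqP.
  by rewrite mulf_eq0 (negbTE (Gn i)) orbF => /eqP.
by move=> x dx; rewrite hE // big1 // => i _; rewrite v0 mul0r.
Qed.

Definition subst_point (z : 'I_n -> T) (i : 'I_n) (x : T) : 'I_n -> T :=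
  fun j => if j == i then x else z j.

(** What the determinants and the product formulas have in common, and what
    suffices to make two such functions proportional. *)
Record alternating_in (A : ('I_n -> T) -> F) : Prop := AlternatingIn {
  alt_space : forall z i, (forall j, dom (z j)) -> V (fun x => A (subst_point z i x));
  alt_coincide : forall z i j, i != j -> z i = z j -> A z = 0 }.

(** As functions of the moved point, [D] with the [k]-th point freed vanishes at
    all other points, so these functions interpolate at [z]; the difference of
    the two sides lies in [V] and vanishes at all the points of [z]. *)
Lemma alternating_move_point (A D : ('I_n -> T) -> F) z i x :
  alternating_in A -> alternating_in D -> (forall j, dom (z j)) -> dom x -> D z != 0 ->
  A (subst_point z i x) * D z = A z * D (subst_point z i x).
Proof.
move=> hA hD hz dx Dz.
have same k : subst_point z k (z k) = z.
  by apply: funext => j; rewrite /subst_point; case: eqP => [->|].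
have coin (B : ('I_n -> T) -> F) k j : alternating_in B -> k != j -> B (subst_point z k (z j)) = 0.
  move=> hB kj; apply: (alt_coincide hB (i := k) (j := j)) => //.
  by rewrite /subst_point eqxx eq_sym (negbTE kj).
apply/eqP; rewrite -subr_eq0; apply/eqP.
pose h y := - A z * D (subst_point z i y) + (D z * A (subst_point z i y) + 0).
have Vh : V h.
  apply: space_lin => //; first exact: (alt_space hD).
  by apply: space_lin => //; [exact: (alt_space hA)|exact: space0].
have := @interpolation_unique z (fun k y => D (subst_point z k y)) h hz.
move=> /(_ (fun k => alt_space hD k hz)) H.
have := H (fun k j kj => coin D k j hD kj) (fun k => _) Vh _ x dx.
rewrite /h => <- => [|k|k]; first by ring.
  by rewrite same.
have [<-|ik] := eqVneq i k; first by rewrite same; ring.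
by rewrite !coin // !mulr0 !addr0.
Qed.

(** The points are moved one at a time from [y] to [x]; the hypothesis keeps the
    intermediate values of [D] away from 0, so that the factors cancel. *)
Lemma alternating_proportional (A D : ('I_n -> T) -> F) (x y : 'I_n -> T) :
  alternating_in A -> alternating_in D -> (forall j, dom (x j)) -> (forall j, dom (y j)) ->
  (forall k, (k < n)%N -> D (fun j : 'I_n => if (j < k)%N then x j else y j) != 0) ->
  A x * D y = A y * D x.
Proof.
move=> hA hD hx hy hne.
pose hyb k := fun j : 'I_n => if (j < k)%N then x j else y j.
have dh k j : dom (hyb k j) by rewrite /hyb; case: ifP.
have h0 : hyb 0%N = y by apply: funext.
have hn : hyb n = x by apply: funext => j; rewrite /hyb ltn_ord.
suff key k : (k <= n)%N -> A (hyb k) * D y = A y * D (hyb k) by rewrite -hn key.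
elim: k => [_|k IH kn]; first by rewrite h0.
have := IH (ltnW kn) => {}IH.
pose i := Ordinal kn.
have step : hyb k.+1 = subst_point (hyb k) i (x i).
  apply: funext => j; rewrite /subst_point /hyb; case: (eqVneq j i) => [->|ji].
    by rewrite ltnSn.
  rewrite ltnS leq_eqVlt (_ : (j == k :> nat) = false) //.
  by apply: contraNF ji => /eqP e; apply/eqP/val_inj.
have := alternating_move_point i hA hD (dh k) (hx i) (hne k kn).
rewrite -step -/(hyb k) => e1.
apply: (mulIf (hne k kn)); rewrite -/(hyb k).
by rewrite mulrAC e1 mulrAC IH; ring.
Qed.

End Interpolation.

Section AlternatingDeterminant.
Variables (F : fieldType) (T : Type) (dom : T -> Prop) (n : nat).
Variables (V : (T -> F) -> Prop) (coord : (T -> F) -> 'rV[F]_n).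
Hypothesis hV : coordinate_space dom V coord.

(** Expansion along row [i] shows the dependence on the [i]-th point. *)
Lemma det_alternating (f : 'I_n -> T -> F) : (forall j, V (f j)) ->
  alternating_in dom V (fun z : 'I_n -> T => \det (\matrix_(i < n, j < n) f j (z i))).
Proof.
move=> hf; split=> [z i hz|z i j ij zij]; last first.
  by apply: (determinant_alternate ij) => k; rewrite !mxE zij.
pose B : 'M[F]_n := \matrix_(i < n, j < n) f j (z i).
rewrite (_ : (fun x => _) = fun x => \sum_j cofactor B i j * f j x).
  exact: (space_comb hV (fun j => cofactor B i j) hf).1.
apply: funext => x; rewrite (expand_det_row _ i); apply: eq_bigr => j _.
rewrite !mxE /subst_point eqxx mulrC; congr (_ * _); rewrite /cofactor; congr (_ * \det _).
apply/matrixP => k l; rewrite !mxE /subst_point.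
by rewrite (_ : (lift i k == i) = false) // eq_sym; apply/negbTE/neq_lift.
Qed.

End AlternatingDeterminant.

(** * Coefficient bounds for spaces of theta functions *)

Section LaurentCoefficients.
Variable R : realType.
Local Notation C := R[i].
Local Notation holo := (@holomorphic_on_punctured_plane R).
Implicit Types (f g : C -> C) (k m : int).

Lemma dyadic_mean_reflect N (g : C -> C) a b :
  dyadic_mean N (fun z => g (- z)) a b = dyadic_mean N g (- b) (- a).
Proof.
elim: N a b => [|N IH] a b /=; first by congr g; field.
rewrite !IH addrC; suff -> : - ((a + b) / 2) = (- b - a) / 2 by [].
by field.
Qed.

Lemma circle_mean_inv f : holo f -> circle_mean (fun x => f x^-1) = circle_mean f.
Proof.
move=> hf; apply: circle_meanE.
have := @circle_mean_cvg R f (- twopii R) hf.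
rewrite addNr [X in X @ _](_ : _ = (fun N => dyadic_mean N (fun z => f (expC z)^-1) 0 (twopii R))) //.
apply: funext => N; rewrite -[X in dyadic_mean _ _ _ X](oppr0 C) -dyadic_mean_reflect.
apply: eq_dyadic_mean => z; congr f; apply: (mulIf (expC_neq0 z)).
by rewrite mulVf ?expC_neq0 // -expCD addNr expC0.
Qed.

Definition laurent_coef f k : C := circle_mean (fun x => x ^ (- k) * f x).

Lemma holo_mulXz k f : holo f -> holo (fun x => x ^ k * f x).
Proof. by move=> hf; exact: holoM (@holoXz R k) hf. Qed.

Lemma eq_laurent_coef f g k : (forall x, x != 0 -> f x = g x) ->
  laurent_coef f k = laurent_coef g k.
Proof. by move=> h; apply: eq_circle_mean => x x0; rewrite h. Qed.

Lemma laurent_coef_lin c f g k : holo f -> holo g ->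
  laurent_coef (fun x => c * f x + g x) k = c * laurent_coef f k + laurent_coef g k.
Proof.
move=> hf hg; rewrite /laurent_coef.
rewrite (@eq_circle_mean _ _ (fun x => c * (x ^ (- k) * f x) + x ^ (- k) * g x)).
  have h1 : holo (fun x => c * (x ^ (- k) * f x)).
    exact: holoM (@holo_cst R c) (@holo_mulXz (- k) f hf).
  rewrite (circle_meanD h1 (@holo_mulXz (- k) g hg)).
  by rewrite (circle_meanZ c (@holo_mulXz (- k) f hf)).
by move=> x _; ring.
Qed.

Lemma laurent_coefZ c f k : holo f ->
  laurent_coef (fun x => c * f x) k = c * laurent_coef f k.
Proof.
move=> hf; rewrite -(circle_meanZ c (@holo_mulXz (- k) f hf)).
by apply: eq_circle_mean => x _; ring.
Qed.

Lemma laurent_coef_scale f w k : holo f -> w != 0 ->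
  laurent_coef (fun x => f (w * x)) k = w ^ k * laurent_coef f k.
Proof.
move=> hf w0; have h := @holo_mulXz (- k) f hf.
rewrite /laurent_coef -(circle_mean_scale h w0).
have -> := esym (circle_meanZ (w ^ k) (holo_scale w0 h)).
apply: eq_circle_mean => x x0.
by rewrite exprzMl ?unitfE // !mulrA -expfzDr // addrN expr0z mul1r.
Qed.

Lemma laurent_coef_mulXz f m k : holo f ->
  laurent_coef (fun x => x ^ m * f x) k = laurent_coef f (k - m).
Proof.
move=> hf; apply: eq_circle_mean => x x0.
by rewrite mulrA -expfzDr // opprB addrC.
Qed.

Lemma laurent_coef_inv f k : holo f ->
  laurent_coef (fun x => f x^-1) k = laurent_coef f (- k).
Proof.
move=> hf; rewrite /laurent_coef -(circle_mean_inv (@holo_mulXz (- - k) f hf)).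
by apply: eq_circle_mean => x x0; rewrite opprK exprz_inv.
Qed.

Lemma laurent_coef_eq0 f : holo f -> (forall k, laurent_coef f k = 0) ->
  forall x, x != 0 -> f x = 0.
Proof.
move=> hf h; apply: holo_eq0 => // k.
by rewrite -[RHS](h (- k)) /laurent_coef opprK.
Qed.

Lemma int_periodic_eq0 (c : int -> C) (N : nat) : (0 < N)%N ->
  (forall k, c (k + N%:Z) = 0 <-> c k = 0) ->
  (forall r : nat, (r < N)%N -> c r%:Z = 0) -> forall k, c k = 0.
Proof.
move=> N0 h h0 k.
have key (r : nat) (q : int) : (r < N)%N -> c (r%:Z + q * N%:Z) = 0.
  move=> rN; elim/int_ind: q => [|q IH|q IH].
  - by rewrite mul0r addr0 h0.
  - by rewrite (_ : _ + _ = r%:Z + q%:Z * N%:Z + N%:Z) ?h //; lia.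
  - by apply/h; rewrite (_ : _ + _ = r%:Z + - q%:Z * N%:Z) //; lia.
have Nz : N%:Z != 0 by lia.
rewrite (divz_eq k N%:Z) addrC.
have r0 := modz_ge0 k Nz; have rl := ltz_mod k Nz.
rewrite -(gez0_abs r0); apply: key; lia.
Qed.

End LaurentCoefficients.

Section ThetaSpaces.
Variable R : realType.
Local Notation C := R[i].
Local Notation holo := (@holomorphic_on_punctured_plane R).
Variable p : C.
Hypothesis hp : 0 < `|p| < 1.

(** Quasi-periodicity is a recursion of step [m] between Laurent coefficients, so
    [m] consecutive ones determine all of them. *)
Lemma A_theta_space (m : nat) (s : C) : (0 < m)%N -> s != 0 ->
  coordinate_space (fun x : C => x != 0) (A_theta p m s)
    (fun f => \row_(k < m) laurent_coef f k%:Z).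
Proof.
move=> m0 s0; have p0 := nome_neq0 hp; split.
- by split=> // x x0; rewrite mulr0.
- move=> c f g [_ _ hf qf] [_ _ hg qg]; split; [exact: m0|exact: s0| |].
    exact: holoD (holoM (@holo_cst R c) hf) hg.
  by move=> x x0; rewrite qf // qg //; ring.
- move=> c f g [_ _ hf _] [_ _ hg _]; apply/rowP => k.
  by rewrite !mxE (laurent_coef_lin _ _ hf hg).
move=> f [_ _ hf qf] h0; apply: (laurent_coef_eq0 hf).
apply: (int_periodic_eq0 m0) => [k|r rm]; last first.
  by have := congr1 (fun M : 'rV_m => M 0 (Ordinal rm)) h0; rewrite !mxE.
have : p ^ k * laurent_coef f k = (-1) ^+ m / s * laurent_coef f (k + m%:Z).
  rewrite -(laurent_coef_scale _ hf p0) -[m%:Z]opprK -(laurent_coef_mulXz _ _ hf).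
  rewrite -(laurent_coefZ _ _ (@holo_mulXz R (- m%:Z) f hf)).
  apply: eq_laurent_coef => x x0; rewrite qf // -invr_expz -exprnP.
  by field; rewrite s0 expf_neq0.
move=> e; split=> h; move: e; rewrite h mulr0.
  by move/eqP; rewrite mulf_eq0 (negbTE (expfz_neq0 _ p0)) => /eqP.
move/esym/eqP; rewrite mulf_eq0 mulf_eq0 invr_eq0 (negbTE s0) signr_eq0 //= => /eqP.
by [].
Qed.

(** The space to which the entries of row [i] belong as functions of [x_i]. *)
Definition C_theta (n : nat) (f : C -> C) : Prop :=
  [/\ holo f, forall x, x != 0 -> f (p * x) = p ^- n.+1 * x ^- (n.+1).*2 * f x
    & forall x, x != 0 -> f x^-1 = - f x].

(** The recursion between Laurent coefficients has step [2n + 2] and the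
    coefficients are odd in the index, so those of index 0 and [n + 1] vanish and
    those of index [1, ..., n] determine all of them. *)
Lemma C_theta_space (n : nat) :
  coordinate_space (fun x : C => x != 0) (C_theta n)
    (fun f => \row_(k < n) laurent_coef f k.+1%:Z).
Proof.
have p0 := nome_neq0 hp; split.
- by split=> [|x x0|x x0]; [exact: holo_cst|rewrite mulr0|rewrite oppr0].
- move=> c f g [hf qf rf] [hg qg rg]; split.
  + exact: holoD (holoM (@holo_cst R c) hf) hg.
  + by move=> x x0; rewrite qf // qg //; ring.
  + by move=> x x0; rewrite rf // rg //; ring.
- move=> c f g [hf _ _] [hg _ _]; apply/rowP => k.
  by rewrite !mxE (laurent_coef_lin _ _ hf hg).
move=> f [hf qf rf] h0; apply: (laurent_coef_eq0 hf).
have odd k : laurent_coef f (- k) = - laurent_coef f k.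
  rewrite -(laurent_coef_inv _ hf) -mulN1r -(laurent_coefZ _ _ hf).
  by apply: eq_laurent_coef => x x0; rewrite rf // mulN1r.
have rec k : p ^ k * laurent_coef f k = p ^- n.+1 * laurent_coef f (k + (n.+1).*2%:Z).
  rewrite -(laurent_coef_scale _ hf p0) -[(n.+1).*2%:Z]opprK -(laurent_coef_mulXz _ _ hf).
  rewrite -(laurent_coefZ _ _ (@holo_mulXz R (- (n.+1).*2%:Z) f hf)).
  apply: eq_laurent_coef => x x0; rewrite qf // -invr_expz -exprnP.
  by rewrite mulrA.
have self (a : C) : a = - a -> a = 0.
  by move=> e; apply/eqP; have := mulrn_eq0 a 2; rewrite mulr2n {2}e subrr eqxx.
have per k : laurent_coef f (k + (n.+1).*2%:Z) = 0 <-> laurent_coef f k = 0.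
  have e := rec k; split=> h; move: e; rewrite h mulr0.
    by move/eqP; rewrite mulf_eq0 (negbTE (expfz_neq0 _ p0)) => /eqP.
  by move/esym/eqP; rewrite mulf_eq0 invr_eq0 expf_eq0 (negbTE p0) andbF => /eqP.
have low (r : nat) : (r <= n)%N -> laurent_coef f r%:Z = 0.
  case: r => [_|r rn]; first by apply: self; rewrite -odd.
  by have := congr1 (fun M : 'rV_n => M 0 (Ordinal rn)) h0; rewrite !mxE.
apply: (int_periodic_eq0 _ per) => // r rN.
have [rn|rn] := leqP r n; first exact: low.
have [->|rn1] := eqVneq r n.+1.
  apply: self; rewrite -odd; have := rec (- n.+1%:Z).
  rewrite -invr_expz -exprnP (_ : _ + _ = n.+1%:Z); last by rewrite -addnn; lia.
  by move/(mulfI _) => -> //; rewrite invr_eq0 expf_neq0.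
rewrite (_ : r%:Z = - ((n.+1).*2 - r)%N%:Z + (n.+1).*2%:Z); last by lia.
by apply/per; rewrite odd low ?oppr0 //; lia.
Qed.

End ThetaSpaces.

(** * Products over pairs of indices *)

Section PairProducts.
Variable F : comNzRingType.
Implicit Types n : nat.

Lemma prod_ord_last n (G : 'I_n.+1 -> F) :
  \prod_(i < n.+1) G i = (\prod_(i < n) G (lift ord_max i)) * G ord_max.
Proof.
rewrite big_ord_recr; congr (_ * _); apply: eq_bigr => i _; congr G.
by apply: ord_inj; rewrite lift_max.
Qed.

Lemma prod_ord_last_cond n (Q : pred nat) (G : 'I_n.+1 -> F) :
  \prod_(i < n.+1 | Q i) G i =
  (\prod_(i < n | Q i) G (lift ord_max i)) * (if Q n then G ord_max else 1).
Proof.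
rewrite big_mkcond prod_ord_last [in RHS]big_mkcond; congr (_ * _).
by apply: eq_bigr => i _; rewrite lift_max.
Qed.

Lemma pairs_last n (G : 'I_n.+1 -> 'I_n.+1 -> F) :
  \prod_(i < n.+1) \prod_(j < n.+1 | (i < j)%N) G i j =
  (\prod_(i < n) \prod_(j < n | (i < j)%N) G (lift ord_max i) (lift ord_max j))
  * \prod_(i < n) G (lift ord_max i) ord_max.
Proof.
rewrite prod_ord_last [X in _ * X]big_pred0 => [|j]; last by rewrite ltnNge -ltnS ltn_ord.
rewrite mulr1 -big_split; apply: eq_bigr => i _; cbv beta.
by rewrite (prod_ord_last_cond (fun j => (lift ord_max i < j)%N)) lift_max ltn_ord.
Qed.

Lemma pairs_split n (i : 'I_n) (G : 'I_n -> 'I_n -> F) :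
  \prod_(a < n) \prod_(b < n | (a < b)%N) G a b =
  (\prod_(j < n | j != i) (if (i < j)%N then G i j else G j i))
  * \prod_(a < n | a != i) \prod_(b < n | (a < b)%N && (b != i)) G a b.
Proof.
have inner (a : 'I_n) : a != i -> \prod_(b < n | (a < b)%N) G a b =
    (if (a < i)%N then G a i else 1) * \prod_(b < n | (a < b)%N && (b != i)) G a b.
  move=> ai; case: ifP => h; first by rewrite (bigD1 i).
  rewrite mul1r; apply: eq_bigl => b; case: (eqVneq b i) => [->|]; rewrite ?h ?andbT //.
rewrite (bigD1 i) //= (eq_bigr _ inner) big_split /= mulrA; congr (_ * _).
rewrite (bigID (fun j => j != i)) /= [X in _ * X * _ = _]big_pred0; last first.
  by move=> j; rewrite negbK; case: eqVneq => [->|]; rewrite ?ltnn ?andbF.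
rewrite mulr1 big_mkcondl -big_split; apply: eq_bigr => j ji /=.
case: ltngtP => h; rewrite ?mulr1 ?mul1r //.
by rewrite (val_inj h) eqxx in ji.
Qed.

Lemma pairs_eq0 n (G : 'I_n -> 'I_n -> F) (i j : 'I_n) : i != j ->
  G i j = 0 -> G j i = 0 -> \prod_(a < n) \prod_(b < n | (a < b)%N) G a b = 0.
Proof.
move=> ij h1 h2; rewrite (pairs_split i) (bigD1 j) 1?eq_sym //=.
by case: ifP => _; rewrite ?h1 ?h2 !mul0r.
Qed.

Lemma det_scale_rows n (d : 'I_n -> F) (M : 'I_n -> 'I_n -> F) :
  \det (\matrix_(i, j) (d i * M i j)) = (\prod_i d i) * \det (\matrix_(i, j) M i j).
Proof.
rewrite -(_ : \det (diag_mx (\row_i d i)) = \prod_i d i); last first.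
  by rewrite det_diag; apply: eq_bigr => i _; rewrite mxE.
rewrite -det_mulmx; congr (\det _); apply/matrixP => i j.
by rewrite mul_diag_mx !mxE.
Qed.

End PairProducts.

(** * Products of theta functions *)

Section ThetaLike.
Variable R : realType.
Local Notation C := R[i].
Local Notation holo := (@holomorphic_on_punctured_plane R).
Variable p : C.
Hypothesis hp : 0 < `|p| < 1.
Local Notation th := (theta p).

(** [A_theta] without the restriction [0 < m], so that constants and empty
    products are included. *)
Definition theta_like (m : nat) (s : C) (f : C -> C) : Prop :=
  [/\ s != 0, holo f &
      forall x, x != 0 -> f (p * x) = (-1) ^+ m / (s * x ^+ m) * f x].

Lemma eq_theta_like m s f g : (forall x, x != 0 -> f x = g x) ->
  theta_like m s f -> theta_like m s g.
Proof.
have p0 := nome_neq0 hp.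
move=> h [s0 hf qf]; split; [exact: s0|exact: eq_holo hf|].
by move=> x x0; rewrite -!h ?mulf_neq0 // qf.
Qed.

Lemma theta_like_cst (c : C) : theta_like 0 1 (fun=> c).
Proof.
split; [exact: oner_neq0|exact: holo_cst|].
by move=> x _; rewrite !expr0 mulr1 divr1 mul1r.
Qed.

Lemma theta_like_theta (c : C) : c != 0 -> theta_like 1 c (fun x => th (c * x)).
Proof.
move=> c0; split; [exact: c0|exact: (holo_scale c0 (holo_theta hp))|].
move=> x x0; rewrite mulrCA theta_nome ?mulf_neq0 //.
by rewrite !expr1 mulN1r.
Qed.

Lemma theta_likeM m s f m' s' g : theta_like m s f -> theta_like m' s' g ->
  theta_like (m + m') (s * s') (fun x => f x * g x).
Proof.
move=> [s0 hf qf] [t0 hg qg]; split; [by rewrite mulf_neq0|exact: holoM hf hg|].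
move=> x x0; rewrite qf // qg // !exprD; field.
by rewrite s0 t0 !expf_neq0.
Qed.

Lemma theta_like_prod (I : finType) (Q : pred I) (c : I -> C) : (forall k, c k != 0) ->
  theta_like #|Q| (\prod_(k | Q k) c k) (fun x => \prod_(k | Q k) th (c k * x)).
Proof.
move=> c0; rewrite -sum1_card.
have key (r : seq I) : theta_like (\sum_(k <- r | Q k) 1) (\prod_(k <- r | Q k) c k)
    (fun x => \prod_(k <- r | Q k) th (c k * x)).
  elim: r => [|k r IH].
    rewrite !big_nil; apply: eq_theta_like (theta_like_cst 1) => x _.
    by rewrite big_nil.
  rewrite !big_cons; case: ifP => Qk; last first.
    by apply: eq_theta_like IH => x _; rewrite big_cons Qk.
  apply: eq_theta_like (theta_likeM (theta_like_theta (c0 k)) IH) => x _.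
  by rewrite big_cons Qk.
exact: key.
Qed.

Lemma A_thetaE m s f : A_theta p m s f <-> (0 < m)%N /\ theta_like m s f.
Proof. by split=> [[h1 h2 h3 h4]|[h1 [h2 h3 h4]]]. Qed.

Lemma theta_div_sym x y : x != 0 -> y != 0 -> y * th (x / y) = - x * th (y / x).
Proof.
move=> x0 y0; rewrite -[x / y]invf_div theta_inv ?mulf_neq0 ?invr_eq0 //.
by rewrite invf_div; field; rewrite y0.
Qed.

Lemma card_gt_ord n (j : 'I_n) : #|[pred k : 'I_n | (j < k)%N]| = (n - j.+1)%N.
Proof.
rewrite -sum1_card -[RHS]muln1 -sum_nat_const_nat.
by rewrite (big_geq_mkord _ _ xpredT (fun=> 1%N)).
Qed.

Lemma theta_like_column n (a : 'I_n -> C) (s : C) (j : 'I_n) (f : C -> C) :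
  (forall k, a k != 0) ->
  theta_like j.+1 (s / \prod_(k < n | (j < k)%N) a k) f ->
  theta_like n s (fun x => f x * \prod_(k < n | (j < k)%N) th (a k * x)).
Proof.
move=> a0 hf; have := theta_likeM hf (theta_like_prod [pred k : 'I_n | (j < k)%N] a0).
rewrite card_gt_ord subnKC // divfK //.
by apply/prodf_neq0.
Qed.

(** The theta analogue of the Vandermonde determinant. The first factor makes it
    a theta function of norm [s] in each variable. *)
Definition A_product n (s : C) (z : 'I_n -> C) : C :=
  th (s * \prod_(i < n) z i) *
  \prod_(i < n) \prod_(j < n | (i < j)%N) (z j * th (z i / z j)).

Lemma A_product_alternating n (s : C) : s != 0 ->
  alternating_in (fun x : C => x != 0) (A_theta p n s) (@A_product n s).
Proof.
move=> s0; split=> [z i hz|z i j ij zij]; last first.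
  rewrite /A_product (@pairs_eq0 _ _ _ i j) ?mulr0 // zij.
    have [->|y0] := eqVneq (z j) 0; first by rewrite mul0r.
    by rewrite divff // theta1 // mulr0.
  have [->|y0] := eqVneq (z j) 0; first by rewrite mul0r.
  by rewrite divff // theta1 // mulr0.
have n0 : (0 < n)%N by apply: leq_ltn_trans (ltn_ord i).
apply/A_thetaE; split; first exact: n0.
pose Z := \prod_(j < n | j != i) z j.
have Z0 : Z != 0 by apply/prodf_neq0 => j _.
pose K := (\prod_(j < n | j != i) (if (i < j)%N then z j else - z j)) *
  \prod_(a < n | a != i) \prod_(b < n | (a < b)%N && (b != i)) (z b * th (z a / z b)).
have iz k : (z k)^-1 != 0 by rewrite invr_eq0.
have := theta_likeM (theta_like_cst K) (theta_likeM (theta_like_theta (mulf_neq0 s0 Z0))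
  (theta_like_prod [pred j | j != i] iz)).
have -> : (0 + (1 + #|[pred j | j != i]|))%N = n.
  by rewrite add0n add1n (cardC1 i) card_ord prednK.
rewrite prodfV mul1r mulfK //; apply: eq_theta_like => x x0.
have hZ : \prod_k subst_point z i x k = x * Z.
  rewrite (bigD1 i) //= /subst_point eqxx; congr (_ * _).
  by apply: eq_bigr => j ji; rewrite (negbTE ji).
rewrite /A_product hZ (pairs_split i) (mulrC x) (mulrA s).
set A := \prod_(_ < _ | _) (if _ then _ else _).
set B := \prod_(_ < _ | _) \prod_(_ < _ | _) _.
have -> : A = (\prod_(j < n | j != i) (if (i < j)%N then z j else - z j)) *
    \prod_(j < n | j != i) th ((z j)^-1 * x).
  rewrite -big_split; apply: eq_bigr => j ji /=.
  rewrite /subst_point eqxx (negbTE ji) (mulrC _^-1 x); case: ifP => _; first by [].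
  exact: theta_div_sym.
have -> : B = \prod_(a < n | a != i) \prod_(b < n | (a < b)%N && (b != i)) (z b * th (z a / z b)).
  apply: eq_bigr => a ai; apply: eq_bigr => b /andP[_ bi].
  by rewrite /subst_point (negbTE ai) (negbTE bi).
by rewrite /K; ring.
Qed.

End ThetaLike.

(** * The determinant of type A *)

Section TypeADeterminant.
Variable R : realType.
Local Notation C := R[i].
Variable p : C.
Hypothesis hp : 0 < `|p| < 1.
Local Notation th := (theta p).

(** Induction on [n]. As functions of the last point both sides are proportional,
    and at [x_n = 1 / a_n] the last row has a single nonzero entry, whose minor is
    up to row factors the determinant of size [n - 1] for the norm [s / a_n]. The
    genericity hypotheses say that the products divided by do not vanish. *)
Lemma det_A n (s : C) (x a : 'I_n -> C) (P : 'I_n -> C -> C) : s != 0 ->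
  (forall i, x i != 0) -> (forall i, a i != 0) ->
  (forall j : 'I_n, theta_like p j.+1 (s / \prod_(k < n | (j < k)%N) a k) (P j)) ->
  (forall i j, i != j -> th (x i / x j) != 0) ->
  (forall i k, th (x i * a k) != 0) ->
  (forall k : nat, (k <= n)%N ->
     th (s * (\prod_(i < n | (i < k)%N) x i) / \prod_(i < n | (k <= i)%N) a i) != 0) ->
  \det (\matrix_(i < n, j < n) (P j (x i) * \prod_(k < n | (j < k)%N) th (a k * x i)))
    * th (s / \prod_(i < n) a i)
  = (\prod_(i < n) P i (1 / a i)) * (\prod_(i < n) a i ^+ i) * A_product p s x.
Proof.
elim: n => [|n IH] in s x a P *.
  move=> _ _ _ _ _ _ _.
  by rewrite det_mx00 /A_product !big_ord0 divr1 !mulr1 !mul1r.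
move=> s0 x0 a0 hP gx gxa gen.
pose m : 'I_n.+1 := ord_max; pose lo (i : 'I_n) : 'I_n.+1 := lift ord_max i.
pose D' := \det (\matrix_(i < n, j < n)
  (P (lo j) (x (lo i)) * \prod_(k < n | (j < k)%N) th (a (lo k) * x (lo i)))).
pose col (j : 'I_n.+1) y := P j y * \prod_(k < n.+1 | (j < k)%N) th (a k * y).
pose A (z : 'I_n.+1 -> C) := \det (\matrix_(i < n.+1, j < n.+1) col j (z i)).
have hV := A_theta_space hp (ltn0Sn n) s0.
have hcol j : A_theta p n.+1 s (col j).
  by apply/A_thetaE; split=> //; exact: theta_like_column.
have hA : alternating_in (fun y : C => y != 0) (A_theta p n.+1 s) A.
  exact: (det_alternating hV hcol).
have hD := A_product_alternating hp n.+1 s0.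
pose z := subst_point x m (a m)^-1.
have z0 j : z j != 0.
  by rewrite /z /subst_point; case: ifP => _; [rewrite invr_eq0; exact: a0|exact: x0].
have zlo i : z (lo i) = x (lo i).
  by rewrite /z /subst_point eq_sym (negbTE (neq_lift _ _)).
have zm : z m = (a m)^-1 by rewrite /z /subst_point eqxx.
pose T := \prod_(i < n) th (a m * x (lo i)).
pose pairs := \prod_(i < n) \prod_(j < n | (i < j)%N) (x (lo j) * th (x (lo i) / x (lo j))).
have Az : A z = P m (1 / a m) * (T * D').
  rewrite /A (expand_det_row _ m) (bigD1 m) //= big1 ?addr0 => [|j jm]; last first.
    rewrite mxE zm /col (bigD1 m) /=; last first.
      by rewrite ltn_neqAle -ltnS ltn_ord andbT; apply: contraNneq jm => e; apply/eqP/ord_inj.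
    by rewrite divff // theta1 // mul0r mulr0 mul0r.
  rewrite mxE zm /col big_pred0 ?mulr1 ?div1r => [|k]; last first.
    by rewrite ltnNge -ltnS ltn_ord.
  congr (_ * _); rewrite /cofactor addnn -mul2n exprM sqrrN expr1n expr1n mul1r.
  rewrite /T /D' -det_scale_rows; congr (\det _); apply/matrixP => i j.
  rewrite !mxE zlo /col (prod_ord_last_cond (fun k => (lo j < k)%N)) lift_max ltn_ord.
  by rewrite -/m; ring.
have DzE : A_product p s z = th (s * (\prod_(i < n) x (lo i)) / a m) *
    (pairs * ((a m) ^- n * T)).
  rewrite /A_product prod_ord_last pairs_last zm (mulrA s); congr (th _ * (_ * _)).
  - by congr (_ * _ / _); apply: eq_bigr => i _; rewrite zlo.
  - by apply: eq_bigr => i _; apply: eq_bigr => j _; rewrite !zlo.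
  rewrite /T -exprVn -[X in _ ^+ X]card_ord -prodr_const -big_split.
  by apply: eq_bigr => i _; rewrite zlo invrK (mulrC (x _)).
have gn : th (s * (\prod_(i < n) x (lo i)) / a m) != 0.
  have := gen n (leqnSn n); rewrite (prod_ord_last_cond (fun i => (i < n)%N)) ltnn mulr1.
  rewrite (prod_ord_last_cond (fun i => (n <= i)%N)) leqnn.
  rewrite (eq_bigl xpredT) => [|i]; last by rewrite ltn_ord.
  by rewrite [X in _ / (X * _)]big_pred0 ?mul1r // => i; rewrite leqNgt ltn_ord.
have pairs0 : pairs != 0.
  apply/prodf_neq0 => i _; apply/prodf_neq0 => j ij; rewrite mulf_neq0 //.
  by apply: gx; rewrite (inj_eq lift_inj); apply: contraTneq ij => ->; rewrite ltnn.
have T0 : T != 0 by apply/prodf_neq0 => i _; rewrite mulrC.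
have Dz0 : A_product p s z != 0.
  rewrite DzE (mulf_neq0 gn) // (mulf_neq0 pairs0) // mulf_neq0 //.
  by rewrite invr_eq0 expf_neq0.
have xz : subst_point z m (x m) = x.
  by apply: funext => j; rewrite /z /subst_point; case: eqP => [->|].
have e1 := alternating_move_point hV m hA hD z0 (x0 m) Dz0.
rewrite xz in e1.
have sE : s / a m / \prod_(i < n) a (lo i) = s / \prod_(i < n.+1) a i.
  by rewrite prod_ord_last -mulrA -invfM (mulrC (a m)).
have hD' : D' * th (s / \prod_(i < n.+1) a i) =
    (\prod_(i < n) P (lo i) (1 / a (lo i))) * (\prod_(i < n) a (lo i) ^+ i)
    * (th (s * (\prod_(i < n) x (lo i)) / a m) * pairs).
  rewrite -sE (IH (s / a m) (fun i => x (lo i)) (fun i => a (lo i)) (fun i => P (lo i))) //.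
  - by rewrite /A_product (mulrAC s).
  - by rewrite mulf_neq0 ?invr_eq0.
  - move=> j; have := hP (lo j).
    rewrite (prod_ord_last_cond (fun k => (lo j < k)%N)) lift_max ltn_ord.
    by rewrite invfM mulrA (mulrAC s).
  - by move=> i j ij; apply: gx; rewrite (inj_eq lift_inj).
  - move=> k kn; have := gen k (leqW kn).
    rewrite (prod_ord_last_cond (fun i => (i < k)%N)) ltnNge kn mulr1.
    rewrite (prod_ord_last_cond (fun i => (k <= i)%N)) kn.
    set X := \prod_(_ < _ | _) _; set Y := \prod_(_ < _ | _) _.
    suff -> : s * X / (Y * a ord_max) = s / a m * X / Y by [].
    by rewrite invfM; ring.
have hpow : \prod_(i < n) a (lift ord_max i) ^+ lift ord_max i = \prod_(i < n) a (lo i) ^+ i.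
  by apply: eq_bigr => i _; rewrite lift_max.
rewrite (prod_ord_last (fun i => P i (1 / a i))) (prod_ord_last (fun i => a i ^+ i)) hpow.
rewrite -/(A x) -/m (_ : a m ^+ m = a m ^+ n) //; apply: (mulIf Dz0).
rewrite mulrAC e1 (mulrAC (A z)) Az.
rewrite (_ : P m (1 / a m) * (T * D') * th (s / \prod_(i < n.+1) a i) =
  P m (1 / a m) * T * (D' * th (s / \prod_(i < n.+1) a i))); last by ring.
rewrite hD' DzE.
by field; rewrite expf_neq0 ?a0.
Qed.

End TypeADeterminant.

(** * Odd and even theta functions *)

Section PairSquares.
Variable F : comNzRingType.

Lemma prod_square_split n (G : 'I_n -> 'I_n -> F) :
  \prod_(i < n) \prod_(k < n) G i k =
  (\prod_(i < n) G i i) * \prod_(i < n) \prod_(j < n | (i < j)%N) (G i j * G j i).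
Proof.
have inner (i : 'I_n) : \prod_(k < n) G i k =
    G i i * ((\prod_(k < n | (i < k)%N) G i k) * \prod_(k < n | (k < i)%N) G i k).
  rewrite (bigD1 i) //= (bigID (fun k : 'I_n => (i < k)%N)) /=; congr (_ * (_ * _)).
    by apply: eq_bigl => k; case: eqVneq => [->|]; rewrite ?ltnn ?andbF.
  apply: eq_bigl => k; rewrite -leqNgt leq_eqVlt.
  case: (eqVneq k i) => [->|ki]; first by rewrite ltnn.
  by rewrite (_ : (k == i :> nat) = false) // -(negbTE ki).
rewrite (eq_bigr _ (fun i _ => inner i)) !big_split /=; congr (_ * _).
rewrite [X in _ * X = _](exchange_big_dep xpredT) //= -big_split.
by apply: eq_bigr => i _ /=; rewrite -big_split.
Qed.

Lemma prod_pairs_snd n (a : 'I_n -> F) :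
  \prod_(i < n) \prod_(j < n | (i < j)%N) a j = \prod_(j < n) a j ^+ j.
Proof.
rewrite (exchange_big_dep xpredT) //=; apply: eq_bigr => j _.
rewrite prodr_const; congr (_ ^+ _); rewrite -sum1_card.
rewrite -[RHS]subn0 -[RHS]muln1 -sum_nat_const_nat big_mkord.
rewrite (big_ord_widen n (fun=> 1%N)) //; exact: ltnW.
Qed.

End PairSquares.

Section TypeCDeterminant.
Variable R : realType.
Local Notation C := R[i].
Local Notation holo := (@holomorphic_on_punctured_plane R).
Variable p : C.
Hypothesis hp : 0 < `|p| < 1.
Local Notation th := (theta p).

(** In each of its variables the type C product is the odd function
    [x^-1 theta(x^2)] times even ones. *)
Definition even_theta (m : nat) (f : C -> C) : Prop :=
  [/\ holo f, forall x, x != 0 -> f (p * x) = p ^- m * x ^- m.*2 * f x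
    & forall x, x != 0 -> f x^-1 = f x].

Lemma even_thetaM m f m' g : even_theta m f -> even_theta m' g ->
  even_theta (m + m') (fun x => f x * g x).
Proof.
move=> [hf qf rf] [hg qg rg]; split; first exact: holoM hf hg.
  by move=> x x0; rewrite qf // qg // doubleD !exprD !invfM; ring.
by move=> x x0; rewrite rf // rg.
Qed.

Lemma even_theta_prod (I : Type) (r : seq I) (Q : pred I) (f : I -> C -> C) :
  (forall i, even_theta 1 (f i)) ->
  even_theta (\sum_(i <- r | Q i) 1) (fun x => \prod_(i <- r | Q i) f i x).
Proof.
move=> hf; elim: r => [|i r IH].
  rewrite big_nil (_ : (fun x => _) = fun=> 1); last by apply: funext => x; rewrite big_nil.
  split; first exact: holo_cst.
    by move=> x _; rewrite !expr0 invr1 !mulr1.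
  by [].
rewrite big_cons (_ : (fun x => _) =
   fun x => if Q i then f i x * \prod_(j <- r | Q j) f j x else \prod_(j <- r | Q j) f j x).
  by case: (Q i) => //; exact: even_thetaM.
by apply: funext => x; rewrite big_cons.
Qed.

Lemma even_theta_pair (y : C) : y != 0 ->
  even_theta 1 (fun x => x^-1 * (th (x * y) * th (x / y))).
Proof.
move=> y0; have p0 := nome_neq0 hp; split.
- have h1 := holo_scale y0 (holo_theta hp).
  have iy0 : y^-1 != 0 by rewrite invr_eq0.
  have h2 := holo_scale iy0 (holo_theta hp).
  have h := holoM (holoV (f := id) (fun x x0 => x0) (@holo_id R)) (holoM h1 h2).
  by apply: eq_holo h => x _; rewrite !(mulrC x).
- move=> x x0; rewrite (_ : x ^- 1.*2 = x ^- 2) // -(mulrA p x) -(mulrA p x y^-1).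
  rewrite !theta_nome ?mulf_neq0 ?invr_eq0 //.
  by field; rewrite x0 y0 p0.
- move=> x x0; rewrite invrK.
  rewrite (_ : x^-1 * y = (x / y)^-1); last by rewrite invf_div mulrC.
  rewrite -invfM !theta_inv ?mulf_neq0 ?invr_eq0 //.
  by field; rewrite x0 y0.
Qed.

Lemma odd_theta_square : [/\ holo (fun x => x^-1 * th (x ^+ 2)),
  forall x, x != 0 -> (p * x)^-1 * th ((p * x) ^+ 2) = p ^- 2 * x ^- 4 * (x^-1 * th (x ^+ 2))
  & forall x, x != 0 -> (x^-1)^-1 * th (x^-1 ^+ 2) = - (x^-1 * th (x ^+ 2))].
Proof.
have p0 := nome_neq0 hp; split.
- have h0 (x : C) : x != 0 -> x ^+ 2 != 0 by move=> x0; rewrite expf_neq0.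
  have h2 := holo_comp h0 (holo_theta hp) (@holoX R _ 2 (@holo_id R)).
  exact: holoM (holoV (f := id) (fun x x0 => x0) (@holo_id R)) h2.
- move=> x x0; rewrite (_ : (p * x) ^+ 2 = p * (p * x ^+ 2)); last by ring.
  rewrite !theta_nome ?mulf_neq0 ?expf_neq0 //.
  by field; rewrite x0 p0.
- move=> x x0; rewrite exprVn theta_inv ?expf_neq0 // invrK.
  by field.
Qed.

Definition C_product n (z : 'I_n -> C) : C :=
  (\prod_(i < n) ((z i)^-1 * th (z i ^+ 2))) *
  \prod_(i < n) \prod_(j < n | (i < j)%N) ((z i)^-1 * (th (z i * z j) * th (z i / z j))).

Lemma C_product_alternating n :
  alternating_in (fun x : C => x != 0) (C_theta p n) (@C_product n).
Proof.
split=> [z i hz|z i j ij zij]; last first.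
  have e k l : z k = z l -> (z k)^-1 * (th (z k * z l) * th (z k / z l)) = 0.
    move=> ->; have [->|y0] := eqVneq (z l) 0; first by rewrite invr0 mul0r.
    by rewrite divff // theta1 // !mulr0.
  by rewrite /C_product (@pairs_eq0 _ _ _ i j) ?mulr0 ?e.
pose K := (\prod_(j < n | j != i) ((z j)^-1 * th (z j ^+ 2))) *
  ((\prod_(j < n | j != i) (if (i < j)%N then 1 else -1)) *
  \prod_(a < n | a != i) \prod_(b < n | (a < b)%N && (b != i))
     ((z a)^-1 * (th (z a * z b) * th (z a / z b)))).
have [hE qE rE] := @even_theta_prod _ (index_enum 'I_n) (fun j => j != i)
  (fun j x => x^-1 * (th (x * z j) * th (x / z j))) (fun j => even_theta_pair (hz j)).
have cE : (\sum_(j < n | j != i) 1 = n.-1)%N by rewrite sum1_card cardC1 card_ord.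
rewrite cE in qE.
have n0 : (0 < n)%N by apply: leq_ltn_trans (ltn_ord i).
have [ho qo ro] := odd_theta_square.
pose f x := K * ((x^-1 * th (x ^+ 2)) *
  \prod_(j < n | j != i) (x^-1 * (th (x * z j) * th (x / z j)))).
have hf : C_theta p n f.
  split.
  - exact: holoM (@holo_cst R K) (holoM ho hE).
  - move=> x x0; rewrite /f qo // qE //.
    have -> : p ^- n.+1 * x ^- (n.+1).*2 = p ^- 2 * x ^- 4 * (p ^- n.-1 * x ^- (n.-1).*2).
      rewrite (_ : n.+1 = 2 + n.-1)%N; last by lia.
      by rewrite doubleD !exprD !invfM; ring.
    by ring.
  - by move=> x x0; rewrite /f ro // rE //; ring.
have fE x : x != 0 -> C_product (subst_point z i x) = f x.
  move=> x0; rewrite /C_product (pairs_split i) (bigD1 i) //=.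
  rewrite {1 2}/subst_point eqxx.
  set A := \prod_(_ < _ | _) _; set B := \prod_(_ < _ | _) (if _ then _ else _).
  set D := \prod_(_ < _ | _) \prod_(_ < _ | _) _.
  have -> : A = \prod_(j < n | j != i) ((z j)^-1 * th (z j ^+ 2)).
    by apply: eq_bigr => j ji; rewrite /subst_point (negbTE ji).
  have -> : B = (\prod_(j < n | j != i) (if (i < j)%N then 1 else -1)) *
      \prod_(j < n | j != i) (x^-1 * (th (x * z j) * th (x / z j))).
    rewrite -big_split; apply: eq_bigr => j ji /=.
    rewrite /subst_point eqxx (negbTE ji); case: ifP => _; first by rewrite mul1r.
    rewrite -[z j / x]invf_div theta_inv ?mulf_neq0 ?invr_eq0 // (mulrC (z j) x).
    by field; rewrite x0 hz.
  have -> : D = \prod_(a < n | a != i) \prod_(b < n | (a < b)%N && (b != i))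
     ((z a)^-1 * (th (z a * z b) * th (z a / z b))).
    apply: eq_bigr => a ai; apply: eq_bigr => b /andP[_ bi].
    by rewrite /subst_point (negbTE ai) (negbTE bi).
  by rewrite /f /K; ring.
have p0 := nome_neq0 hp; have [h1 h2 h3] := hf; split.
- by apply: eq_holo h1 => x x0; rewrite fE.
- by move=> x x0; rewrite !fE ?mulf_neq0 // h2.
- by move=> x x0; rewrite !fE ?invr_eq0 // h3.
Qed.

Lemma C_theta_antisymmetrize n (f : C -> C) : holo f ->
  (forall x, x != 0 -> f (p * x) = p ^- n.+1 * x ^- (n.+1).*2 * f x) ->
  C_theta p n (fun x => f x - f x^-1).
Proof.
have p0 := nome_neq0 hp.
move=> hf qf; split.
- exact: holoB hf (holo_inv hf).
- move=> x x0; rewrite qf // mulrBr; congr (_ - _).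
  have px0 : (p * x)^-1 != 0 by rewrite invr_eq0 mulf_neq0.
  have := qf _ px0; rewrite (_ : p * (p * x)^-1 = x^-1); last by field; rewrite x0 p0.
  move=> ->; rewrite mulrA -[LHS]mul1r; congr (_ * _).
  rewrite exprVn invrK exprMn -addnn exprD (exprD p).
  by field; rewrite !expf_neq0.
- by move=> x x0; rewrite invrK opprB.
Qed.

End TypeCDeterminant.

(** * The determinant for generic parameters *)

Section GenericDeterminant.
Variable R : realType.
Local Notation C := R[i].
Local Notation holo := (@holomorphic_on_punctured_plane R).
Variable p : C.
Hypothesis hp : 0 < `|p| < 1.
Local Notation th := (theta p).
Variable n : nat.
Implicit Types (x a : 'I_n -> C) (c : 'I_n.+2 -> C) (P : 'I_n -> C -> C).

Definition det_entry c a P (j : 'I_n) (y : C) : C :=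
  y ^- n.+1 * (\prod_(k < n.+2) th (c k * y)) * P j y
    * (\prod_(k < n | (j < k)%N) th (a k * y))
  - y ^+ n.+1 * (\prod_(k < n.+2) th (c k * y^-1)) * P j y^-1
    * (\prod_(k < n | (j < k)%N) th (a k * y^-1)).

Definition norm_condition c a P := forall j : 'I_n,
  theta_like p j.+1 ((\prod_(k < n.+2) c k) * \prod_(k < n | (j < k)%N) a k)^-1 (P j).

Lemma det_entry_C_theta c a P j : (forall k, c k != 0) -> (forall k, a k != 0) ->
  norm_condition c a P -> C_theta p n (det_entry c a P j).
Proof.
move=> c0 a0 hP; have p0 := nome_neq0 hp.
have C0 : \prod_(k < n.+2) c k != 0 by apply/prodf_neq0.
pose g y := (\prod_(k < n.+2) th (c k * y)) * (P j y * \prod_(k < n | (j < k)%N) th (a k * y)).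
have [_ hg qg] : theta_like p (n.+1).*2 1 g.
  have h1 := theta_like_prod hp predT c0; rewrite card_ord in h1.
  have h2 : theta_like p n (\prod_(k < n.+2) c k)^-1
      (fun y => P j y * \prod_(k < n | (j < k)%N) th (a k * y)).
    by apply: theta_like_column => //; have := hP j; rewrite invfM.
  have := theta_likeM h1 h2; rewrite divff //.
  by rewrite (_ : n.+2 + n = (n.+1).*2)%N //; lia.
pose f y := y ^- n.+1 * g y.
have hf : holo f.
  have h0 (y : C) : y != 0 -> y ^+ n.+1 != 0 by move=> y0; rewrite expf_neq0.
  exact: holoM (holoV h0 (@holoX R _ n.+1 (@holo_id R))) hg.
have qf y : y != 0 -> f (p * y) = p ^- n.+1 * y ^- (n.+1).*2 * f y.
  move=> y0; rewrite /f qg // -signr_odd odd_double expr0 mul1r mul1r exprMn invfM.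
  by ring.
rewrite (_ : det_entry c a P j = fun y => f y - f y^-1).
  exact: C_theta_antisymmetrize.
apply: funext => y; rewrite /det_entry /f /g exprVn invrK.
by rewrite !mulrA.
Qed.

Definition embed (i : 'I_n) : 'I_n.+2 := lift ord_max (lift ord_max i).

Lemma prod_last_two (G : 'I_n.+2 -> C) :
  \prod_(k < n.+2) G k =
  (\prod_(i < n) G (embed i)) * G (lift ord_max ord_max) * G ord_max.
Proof. by rewrite !prod_ord_last. Qed.

(** The factor [theta(c_i / x_i)] kills the second half of every entry of row
    [i] at [x_i = c_i], which leaves a determinant of type A. *)
Lemma det_at_c c a P : (forall k, c k != 0) -> (forall k, a k != 0) ->
  \det (\matrix_(i < n, j < n) det_entry c a P j (c (embed i))) =
  (\prod_(i < n) (c (embed i) ^- n.+1 * \prod_(k < n.+2) th (c k * c (embed i)))) *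
  \det (\matrix_(i < n, j < n)
    (P j (c (embed i)) * \prod_(k < n | (j < k)%N) th (a k * c (embed i)))).
Proof.
move=> c0 a0; rewrite -det_scale_rows; congr (\det _); apply/matrixP => i j.
rewrite !mxE /det_entry [X in _ - _ * X * _ * _](bigD1 (embed i)) //=.
by rewrite divff // theta1 // mul0r mulr0 !mul0r subr0 !mulrA.
Qed.

(** The determinant is proportional to the type C product in [x], and the factor
    is found at [x = (c_1, ..., c_n)]. There the type A evaluation contributes
    [theta(c_1 ... c_n / (c_1 ... c_(n+2)))], which is the remaining factor
    [theta(c_(n+1) c_(n+2))] up to a monomial. *)
Lemma det_C_generic x a c P :
  (forall i, x i != 0) -> (forall i, a i != 0) -> (forall k, c k != 0) ->
  th ((\prod_(k < n.+2) c k) * \prod_(i < n) a i) != 0 ->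
  norm_condition c a P ->
  (forall i j, i != j -> th (c (embed i) / c (embed j)) != 0) ->
  (forall i k, th (c (embed i) * a k) != 0) ->
  (forall k : nat, (k <= n)%N ->
     th ((\prod_(k < n.+2) c k)^-1 * (\prod_(i < n | (i < k)%N) c (embed i))
         / \prod_(i < n | (k <= i)%N) a i) != 0) ->
  (forall k : nat, (k <= n)%N ->
     C_product p (fun j : 'I_n => if (j < k)%N then x j else c (embed j)) != 0) ->
  \det (\matrix_(i < n, j < n) det_entry c a P j (x i))
  = (\prod_(i < n) a i)
      / th ((\prod_(k < n.+2) c k) * \prod_(i < n) a i)
    * (\prod_(i < n) P i (1 / a i))
    * (\prod_(i < n.+2) \prod_(j < n.+2 | (i < j)%N) th (c i * c j))
    * (\prod_(i < n) ((x i)^-1 * th (x i ^+ 2)))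
    * (\prod_(i < n) \prod_(j < n | (i < j)%N)
         (a j * (x i)^-1 * theta_pm p (x i) (x j))).
Proof.
move=> x0 a0 c0 hden hP g1 g2 g3 g4.
pose e := embed; pose y i := c (e i).
have y0 i : y i != 0 by exact: c0.
have hV := C_theta_space hp n.
have hA := det_alternating hV (fun j => det_entry_C_theta j c0 a0 hP).
have e1 := alternating_proportional hV hA (C_product_alternating hp n) x0 y0
   (fun k kn => g4 k (ltnW kn)).
have Dy0 : C_product p y != 0.
  by have := g4 0%N (leq0n n); rewrite (_ : (fun _ => _) = y).
pose CC := \prod_(k < n.+2) c k; pose AA := \prod_(i < n) a i.
have CC0 : CC != 0 by apply/prodf_neq0.
have AA0 : AA != 0 by apply/prodf_neq0.
pose DA := \det (\matrix_(i < n, j < n) (P j (y i) * \prod_(k < n | (j < k)%N) th (a k * y i))).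
have iCC0 : CC^-1 != 0 by rewrite invr_eq0.
have hP' (j : 'I_n) : theta_like p j.+1 (CC^-1 / \prod_(k < n | (j < k)%N) a k) (P j).
  by have := hP j; rewrite invfM.
have e2 : DA * th (CC^-1 / AA) = _ := det_A hp iCC0 y0 a0 hP' g1 g2 g3.
pose c1 := c (lift ord_max ord_max); pose c2 := c ord_max.
pose Y := \prod_(i < n) y i.
have Y0 : Y != 0 by apply/prodf_neq0.
have CE : CC = Y * c1 * c2 by rewrite /CC prod_last_two.
have c10 : c1 != 0 by exact: c0.
have c20 : c2 != 0 by exact: c0.
pose TT := th (CC * AA).
rewrite -invfM theta_inv ?mulf_neq0 // -/TT in e2.
rewrite /A_product (_ : CC^-1 * \prod_(i < n) y i = (c1 * c2)^-1) in e2; last first.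
  by rewrite CE -/Y; field; rewrite c10 c20 Y0.
rewrite theta_inv ?mulf_neq0 // in e2.
(* From here on only products over indices and pairs are compared. *)
pose S1 := \prod_(i < n) \prod_(j < n | (i < j)%N) th (y i * y j).
pose S2 := \prod_(i < n) \prod_(j < n | (i < j)%N) th (y i / y j).
pose Q := \prod_(i < n) th (y i ^+ 2).
pose U1 := \prod_(i < n) th (y i * c1); pose U2 := \prod_(i < n) th (y i * c2).
pose W := \prod_(i < n) \prod_(j < n | (i < j)%N) y j.
pose W' := \prod_(i < n) \prod_(j < n | (i < j)%N) y i.
have W0 : W != 0 by apply/prodf_neq0 => i _; apply/prodf_neq0.
have W'0 : W' != 0 by apply/prodf_neq0 => i _; apply/prodf_neq0.
have YW : Y ^+ n = Y * (W' * W).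
  rewrite /Y -prodrXl; have := prod_square_split (fun i _ : 'I_n => y i).
  rewrite (eq_bigr (fun i => y i ^+ n)) => [->|i _]; last by rewrite prodr_const card_ord.
  congr (_ * _); rewrite -big_split; apply: eq_bigr => i _ /=.
  by rewrite -big_split.
have A2 : \prod_(i < n) \prod_(j < n | (i < j)%N) (y j * th (y i / y j)) = W * S2.
  by rewrite -big_split; apply: eq_bigr => i _ /=; rewrite -big_split.
have DyE : C_product p y = Y^-1 * Q * (W'^-1 * (S1 * S2)).
  rewrite /C_product big_split /= prodfV; congr (_ * _).
  rewrite -prodfV -!big_split; apply: eq_bigr => i _ /=.
  by rewrite -prodfV -!big_split.
have RE : \prod_(i < n) (y i ^- n.+1 * \prod_(k < n.+2) th (c k * y i)) =
    (Y ^+ n.+1)^-1 * (Q * (S1 * S1) * U1 * U2).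
  rewrite big_split /= prodfV prodrXl; congr (_ * _).
  under eq_bigr do rewrite prod_last_two.
  rewrite 2!big_split /=; congr (_ * _ * _); last 2 first.
  - by rewrite /U1; apply: eq_bigr => i _; rewrite mulrC.
  - by rewrite /U2; apply: eq_bigr => i _; rewrite mulrC.
  rewrite (prod_square_split (fun i k : 'I_n => th (y k * y i))); congr (_ * _).
  rewrite /S1 -big_split; apply: eq_bigr => i _ /=; rewrite -big_split; apply: eq_bigr => j _ /=.
  by rewrite (mulrC (y j)).
have QE : \prod_(i < n.+2) \prod_(j < n.+2 | (i < j)%N) th (c i * c j) =
    S1 * U1 * (U2 * th (c1 * c2)).
  by rewrite !pairs_last prod_ord_last.
have e3 := det_at_c P c0 a0; rewrite -/DA RE in e3.
have xE : \prod_(i < n) \prod_(j < n | (i < j)%N) (a j * (x i)^-1 * theta_pm p (x i) (x j)) =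
    (\prod_(i < n) a i ^+ i) *
    \prod_(i < n) \prod_(j < n | (i < j)%N) ((x i)^-1 * (th (x i * x j) * th (x i / x j))).
  rewrite -prod_pairs_snd -big_split; apply: eq_bigr => i _ /=.
  by rewrite -big_split; apply: eq_bigr => j _ /=; rewrite -mulrA.
rewrite QE xE -/CC -/AA -/TT; apply: (mulIf Dy0); rewrite e1 e3.
set PP := \prod_(i < n) P i _ in e2 *; set AX := \prod_(i < n) a i ^+ i in e2 *.
rewrite A2 in e2.
have TT0 : TT != 0 by exact: hden.
have {}e2 : DA = PP * AX * AA * Y * th (c1 * c2) * (W * S2) / TT.
  apply: (mulIf TT0); rewrite divfK //.
  have CA0 : - (CC * AA)^-1 != 0 by rewrite oppr_eq0 invr_eq0 mulf_neq0.
  apply: (mulIf CA0); rewrite mulrAC -mulrA e2 CE.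
  by field; rewrite c10 c20 Y0 AA0.
rewrite e2 DyE /C_product.
set X1 := \prod_(i < n) _; set X2 := \prod_(i < n) _.
rewrite exprS YW.
by field; rewrite TT0 Y0 W0 W'0.
Qed.

End GenericDeterminant.

(** * Small perturbations *)

Section Perturbation.
Variable R : realType.
Local Notation C := R[i].
Local Notation holo := (@holomorphic_on_punctured_plane R).

Definition tends (u : nat -> C) (l : C) := (u : nat -> C^o) @ \oo --> (l : C^o).

Lemma tends_cst (l : C) : tends (fun=> l) l.
Proof. exact: cvg_cst. Qed.

Lemma tendsD u v l m : tends u l -> tends v m -> tends (fun N => u N + v N) (l + m).
Proof. by move=> hu hv; exact: cvgD hu hv. Qed.

Lemma tendsM u v l m : tends u l -> tends v m -> tends (fun N => u N * v N) (l * m).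
Proof. by move=> hu hv; exact: cvgM hu hv. Qed.

Lemma tendsN u l : tends u l -> tends (fun N => - u N) (- l).
Proof. by move=> hu; exact: cvgN hu. Qed.

Lemma tends_prod (I : Type) (r : seq I) (Q : pred I) (u : I -> nat -> C) (l : I -> C) :
  (forall i, Q i -> tends (u i) (l i)) ->
  tends (fun N => \prod_(i <- r | Q i) u i N) (\prod_(i <- r | Q i) l i).
Proof.
move=> h; elim: r => [|i r IH].
  rewrite big_nil (_ : (fun N => _) = fun=> 1); first exact: tends_cst.
  by apply: funext => N; rewrite big_nil.
rewrite big_cons (_ : (fun N => _) = fun N => if Q i then u i N * \prod_(j <- r | Q j) u j N
  else \prod_(j <- r | Q j) u j N); last by apply: funext => N; rewrite big_cons.
case: ifP => Qi; last exact: IH.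
exact: tendsM (h i Qi) IH.
Qed.

Lemma tends_sum (I : Type) (r : seq I) (u : I -> nat -> C) (l : I -> C) :
  (forall i, tends (u i) (l i)) ->
  tends (fun N => \sum_(i <- r) u i N) (\sum_(i <- r) l i).
Proof.
move=> h; elim: r => [|i r IH].
  rewrite big_nil (_ : (fun N => _) = fun=> 0); first exact: tends_cst.
  by apply: funext => N; rewrite big_nil.
rewrite big_cons (_ : (fun N => _) = fun N => u i N + \sum_(j <- r) u j N).
  exact: tendsD (h i) IH.
by apply: funext => N; rewrite big_cons.
Qed.

Lemma tends_det n (M : nat -> 'M[C]_n) (M' : 'M[C]_n) :
  (forall i j, tends (fun N => M N i j) (M' i j)) ->
  tends (fun N => \det (M N)) (\det M').
Proof.
move=> h; apply: tends_sum => s; apply: tendsM; first exact: tends_cst.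
by apply: tends_prod => i _; exact: h.
Qed.

Lemma tends_holo f u l : holo f -> l != 0 -> tends u l -> tends (fun N => f (u N)) (f l).
Proof.
move=> hf l0 hu; apply/cvgCP => e e0.
have [d d0 hd] := derivable_near (hf l l0) e0.
by have [N hN] := (cvgCP _ _).1 hu d d0; exists N => k /hN /hd.
Qed.

Lemma tends_near_neq0 u l : l != 0 -> tends u l -> \forall N \near \oo, u N != 0.
Proof.
move=> l0 hu; have n0 : 0 < normc l / 2 by rewrite divr_gt0 // normc_gt0.
have [N hN] := (cvgCP _ _).1 hu _ n0; exists N => // k /= /hN h.
apply/eqP => e; move: h; rewrite e sub0r normcN.
by move: n0; lra.
Qed.

Lemma tends_unique u v l m : tends u l -> tends v m ->
  (\forall N \near \oo, u N = v N) -> l = m.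
Proof.
move=> hu hv [N0 _ h].
apply/eqP; rewrite -subr_eq0 -normc_eq0 eq_le normc_ge0 andbT.
apply/ler_addgt0Pr => e e0; rewrite add0r.
have e2 : 0 < e / 2 by rewrite divr_gt0.
have [N1 h1] := (cvgCP _ _).1 hu _ e2.
have [N2 h2] := (cvgCP _ _).1 hv _ e2.
pose N := maxn N0 (maxn N1 N2).
have k0 := h N (leq_maxl _ _).
have k1 : normc (u N - l) <= e / 2.
  by apply: h1; rewrite /N (leq_trans (leq_maxl _ _) (leq_maxr _ _)).
have k2 : normc (v N - m) <= e / 2.
  by apply: h2; rewrite /N (leq_trans (leq_maxr _ _) (leq_maxr _ _)).
rewrite (_ : l - m = (v N - m) - (u N - l)); last by rewrite k0; ring.
by apply: le_trans (le_normcD _ _) _; rewrite normcN; lra.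
Qed.

(** The perturbation parameter. It is real and larger than 1, so its nonzero
    powers close to 1 are not powers of the nome. *)
Definition tau (N : nat) : C := (1 + (N.+1%:R)^-1 : R)%:C.

Lemma normc_tau_gt1 N : 1 < normc (tau N).
Proof.
rewrite normc_real ger0_norm ?addr_ge0 ?invr_ge0 //.
by rewrite ltrDl invr_gt0.
Qed.

Lemma tau_neq0 N : tau N != 0.
Proof. by rewrite -normc_gt0 (lt_trans ltr01) // normc_tau_gt1. Qed.

Lemma tends_tau : tends tau 1.
Proof.
apply/cvgCP => e e0.
have [N _ hN] := (cvgrPdist_le _ _).1 (@cvg_harmonic R) e e0.
exists N => k kN.
have h : `|(k.+1%:R^-1 : R)| <= e by have := hN k kN; rewrite /= sub0r normrN.
have -> : tau k - 1 = (k.+1%:R^-1)%:C by rewrite /tau; simpc; rewrite addrAC subrr add0r.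
by rewrite normc_real.
Qed.

Lemma tends_tauXz (m : int) : tends (fun N => tau N ^ m) 1.
Proof. by rewrite -(exp1rz C m); exact: tends_holo (@holoXz R m) (oner_neq0 C) tends_tau. Qed.

Lemma tends_perturb (y : C) (m : int) : tends (fun N => y * tau N ^ m) y.
Proof. by have h := tendsM (@tends_cst y) (tends_tauXz m); rewrite mulr1 in h; exact: h. Qed.

Lemma normcXz (x : C) (m : int) : normc (x ^ m) = normc x ^ m.
Proof. by case: m => k; rewrite ?NegzE -?invr_expz ?normcV -?exprnP normcX. Qed.

Section PerturbTheta.
Variable p : C.
Hypothesis hp : 0 < `|p| < 1.
Local Notation th := (theta p).

Lemma tends_theta u l : l != 0 -> tends u l -> tends (fun N => th (u N)) (th l).
Proof. exact: tends_holo (holo_theta hp). Qed.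

(** If both [y] and its perturbation were zeros, the ratio [tau ^ m] would be a
    power of [p] of modulus close but not equal to 1. *)
Lemma theta_near_neq0 (y : C) (m : int) : y != 0 -> m != 0 ->
  \forall N \near \oo, th (y * tau N ^ m) != 0.
Proof.
move=> y0 m0; have [ty|ty] := eqVneq (th y) 0; last first.
  exact: (@tends_near_neq0 _ _ ty (@tends_theta _ y y0 (@tends_perturb y m))).
have [k yk] := theta_eq0 hp y0 ty.
have /andP[r0 r1] := nome_modulus hp; have p0 := nome_neq0 hp.
have e0 : 0 < (1 - normc p) / 2 by lra.
have [N hN] := (cvgCP _ _).1 (tends_tauXz m) _ e0; exists N => // j /= /hN h.
have t0 : tau j ^ m != 0 by rewrite expfz_neq0 // tau_neq0.
apply/eqP => /(theta_eq0 hp (mulf_neq0 y0 t0)) [l hl].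
have tl : tau j ^ m = p ^ (l - k).
  by rewrite expfzDr // -invr_expz -hl -yk mulrAC divff // mul1r.
have hq : normc (tau j) ^ m = normc p ^ (l - k) by rewrite -!normcXz tl.
have n1 : normc (tau j) ^ m != 1.
  have h1 := normc_tau_gt1 j.
  by rewrite pexprz_eq1 ?normc_ge0 // (negbTE m0) gt_eqF.
have b1 : normc (tau j ^ m) <= 1 + (1 - normc p) / 2.
  have := le_normcD 1 (tau j ^ m - 1); rewrite addrC subrK normc1; lra.
have b2 : 1 - (1 - normc p) / 2 <= normc (tau j ^ m).
  have := le_normcD (tau j ^ m) (1 - tau j ^ m).
  by rewrite addrC subrK normc1 normc_distC; lra.
rewrite normcXz hq in b1 b2; rewrite hq in n1.
case: (l - k) n1 b1 b2 => [[|q]|q].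
- by rewrite expr0z eqxx.
- move=> _ _; rewrite -exprnP exprS => b2.
  have : normc p * normc p ^+ q <= normc p.
    by rewrite ler_piMr ?(ltW r0) // exprn_ile1 // ltW.
  by lra.
move=> _ + _; rewrite NegzE -invr_expz -exprnP => b1.
have c0 : 0 < normc p ^+ q.+1 by rewrite exprn_gt0.
have c1 : normc p ^+ q.+1 <= normc p.
  by rewrite exprS ler_piMr ?(ltW r0) // exprn_ile1 // ltW.
have : 1 <= (1 + (1 - normc p) / 2) * normc p ^+ q.+1.
  by rewrite -ler_pdivrMr // div1r.
by nra.
Qed.

End PerturbTheta.
End Perturbation.

Section GenericPerturbation.
Variable R : realType.
Local Notation C := R[i].
Variable p : C.
Hypothesis hp : 0 < `|p| < 1.
Local Notation th := (theta p).
Variables (n : nat) (x a : 'I_n -> C) (c : 'I_n.+2 -> C).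
Hypotheses (hx : forall i, x i != 0) (ha : forall i, a i != 0) (hc : forall k, c k != 0).

(** The exponents sum to zero, so the product of the [c_k] and with it the
    conditions on the [P_j] are unaffected. Those of [c_1, ..., c_n] and of
    [x_1, ..., x_n] are positive and pairwise distinct, so every theta function
    that has to be nonzero is perturbed, except the one assumed to be nonzero. *)
Definition c_exponent (k : nat) : int :=
  if (k < n)%N then k.+1%:Z else if k == n then - (\sum_(i < n) i.+1)%N%:Z else 0.

Definition c_near N (k : 'I_n.+2) : C := c k * tau R N ^ c_exponent k.

Definition x_near N (i : 'I_n) : C := x i * tau R N ^ (n + i.+1)%:Z.

Lemma c_near_neq0 N k : c_near N k != 0.
Proof. by rewrite mulf_neq0 // expfz_neq0 // tau_neq0. Qed.

Lemma x_near_neq0 N i : x_near N i != 0.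
Proof. by rewrite mulf_neq0 // expfz_neq0 // tau_neq0. Qed.

Lemma c_exponent_embed (i : 'I_n) : c_exponent (embed i) = i.+1%:Z.
Proof. by rewrite /c_exponent !lift_max ltn_ord. Qed.

Lemma c_near_embed N i : c_near N (embed i) = c (embed i) * tau R N ^ i.+1%:Z.
Proof. by rewrite /c_near c_exponent_embed. Qed.

Lemma prod_c_near N : \prod_(k < n.+2) c_near N k = \prod_(k < n.+2) c k.
Proof.
have h : \prod_(k < n.+2) tau R N ^ c_exponent k = 1.
  rewrite prod_last_two (eq_bigr (fun i : 'I_n => tau R N ^+ i.+1)) => [|i _]; last first.
    by rewrite c_exponent_embed.
  rewrite lift_max {1}/c_exponent ltnn eqxx {1}/c_exponent ltnNge leqnSn gtn_eqF //.
  by rewrite expr0z mulr1 prodrXr -invr_expz -exprnP mulfV // expf_neq0 // tau_neq0.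
by rewrite big_split /= h mulr1.
Qed.

Lemma perturb_div (y z t : C) (k l : int) : t != 0 ->
  (y * t ^ k) / (z * t ^ l) = y / z * t ^ (k - l).
Proof. by move=> t0; rewrite expfzDr // -invr_expz invfM; ring. Qed.

Lemma perturb_mul (y z t : C) (k l : int) : t != 0 ->
  (y * t ^ k) * (z * t ^ l) = y * z * t ^ (k + l).
Proof. by move=> t0; rewrite expfzDr //; ring. Qed.

Lemma near_imply (b : bool) (Q : nat -> Prop) :
  (b -> \forall N \near \oo, Q N) -> \forall N \near \oo, b -> Q N.
Proof.
case: b => h; first by apply: filterS (h isT) => N q _.
by apply: nearW.
Qed.

Lemma near_c_distinct : \forall N \near \oo, forall i j : 'I_n, i != j ->
  th (c_near N (embed i) / c_near N (embed j)) != 0.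
Proof.
apply: filter_forall => i; apply: filter_forall => j; apply: near_imply => ij.
have k0 : i.+1%:Z - j.+1%:Z != 0 :> int by rewrite subr_eq0; move: ij; rewrite -val_eqE /=; lia.
have y0 : c (embed i) / c (embed j) != 0 by rewrite mulf_neq0 ?invr_eq0.
apply: filterS (theta_near_neq0 hp y0 k0) => N.
by rewrite !c_near_embed perturb_div // tau_neq0.
Qed.

Lemma near_c_a : \forall N \near \oo, forall i k : 'I_n, th (c_near N (embed i) * a k) != 0.
Proof.
apply: filter_forall => i; apply: filter_forall => k.
have k0 : i.+1%:Z != 0 :> int by [].
apply: filterS (theta_near_neq0 hp (mulf_neq0 (hc (embed i)) (ha k)) k0) => N.
by rewrite c_near_embed mulrAC.
Qed.

Lemma near_partial_norm : th ((\prod_(k < n.+2) c k) * \prod_(i < n) a i) != 0 ->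
  \forall N \near \oo, forall k : 'I_n.+1,
  th ((\prod_(k < n.+2) c k)^-1 * (\prod_(i < n | (i < k)%N) c_near N (embed i))
     / \prod_(i < n | (k <= i)%N) a i) != 0.
Proof.
move=> hden; apply: filter_forall => k.
have C0 : (\prod_(k < n.+2) c k) != 0 by apply/prodf_neq0.
have A0 : \prod_(i < n | (k <= i)%N) a i != 0 by apply/prodf_neq0.
have Y0 : \prod_(i < n | (i < k)%N) c (embed i) != 0 by apply/prodf_neq0.
have [k0|k0] := eqVneq (k : nat) 0%N.
  apply: nearW => N; rewrite k0 [X in _ * X / _]big_pred0 // mulr1.
  have AA0 : \prod_(i < n) a i != 0 by apply/prodf_neq0.
  rewrite -invfM (theta_inv hp); last by rewrite mulf_neq0.
  by apply: mulf_neq0 => //; rewrite oppr_eq0 invr_eq0 mulf_neq0.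
have e0 : (\sum_(i < n | (i < k)%N) i.+1)%N%:Z != 0 :> int.
  have kn : (k <= n)%N by rewrite -ltnS.
  have n0 : (0 < n)%N by apply: leq_trans kn; rewrite lt0n.
  by rewrite (bigD1 (Ordinal n0)) //= lt0n.
have y0 : (\prod_(k < n.+2) c k)^-1 * (\prod_(i < n | (i < k)%N) c (embed i))
     / \prod_(i < n | (k <= i)%N) a i != 0.
  by rewrite !mulf_neq0 ?invr_eq0.
apply: filterS (theta_near_neq0 hp y0 e0) => N h.
rewrite (eq_bigr (fun i : 'I_n => c (embed i) * tau R N ^+ i.+1)) => [|i _].
  rewrite big_split /= prodrXr; move: h; rewrite -exprnP.
  set A := _^-1; set X := \prod_(_ < _ | _) _; set T := tau _ _ ^+ _; set B := \prod_(_ < _ | _) _.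
  by rewrite (_ : A * (X * T) / B = A * X / B * T) //; ring.
exact: c_near_embed.
Qed.

(** The tuples met when [c_1, ..., c_n] is moved to [x_1, ..., x_n]. *)
Lemma near_hybrid : \forall N \near \oo, forall k : 'I_n.+1,
  C_product p (fun j : 'I_n => if (j < k)%N then x_near N j else c_near N (embed j)) != 0.
Proof.
apply: filter_forall => k.
pose w (j : 'I_n) := if (j < k)%N then x j else c (embed j).
pose E (j : 'I_n) := if (j < k)%N then (n + j.+1)%N else j.+1.
have w0 j : w j != 0 by rewrite /w; case: ifP.
have zE N (j : 'I_n) : (if (j < k)%N then x_near N j else c_near N (embed j)) =
    w j * tau R N ^ (E j)%:Z.
  by rewrite /w /E; case: ifP => // _; rewrite c_near_embed.
have E0 j : (0 < E j)%N by rewrite /E; case: ifP => // _; rewrite addnS.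
have h1 : \forall N \near \oo, forall i, th (w i ^+ 2 * tau R N ^ ((E i)%:Z + (E i)%:Z)) != 0.
  apply: filter_forall => i; apply: theta_near_neq0 => //; first by rewrite expf_neq0.
  by have := E0 i; lia.
have h2 : \forall N \near \oo, forall i j, th (w i * w j * tau R N ^ ((E i)%:Z + (E j)%:Z)) != 0.
  apply: filter_forall => i; apply: filter_forall => j.
  apply: theta_near_neq0 => //; first by rewrite mulf_neq0.
  by have := E0 i; lia.
have h3 : \forall N \near \oo, forall i j : 'I_n, (i < j)%N ->
    th (w i / w j * tau R N ^ ((E i)%:Z - (E j)%:Z)) != 0.
  apply: filter_forall => i; apply: filter_forall => j; apply: near_imply => ij.
  apply: theta_near_neq0 => //; first by rewrite mulf_neq0 ?invr_eq0.
  rewrite subr_eq0 /E; have := ltn_ord j; move: ij.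
  by case: ifP; case: ifP; lia.
apply: filterS (filterI h1 (filterI h2 h3)) => N [k1 [k2 k3]].
have t0 := tau_neq0 R N.
have z0 j : w j * tau R N ^ (E j)%:Z != 0 by rewrite mulf_neq0 ?expfz_neq0.
rewrite /C_product; apply: mulf_neq0; apply/prodf_neq0 => i _.
  rewrite !zE; apply: mulf_neq0; first by rewrite invr_eq0.
  by rewrite expr2 perturb_mul // -expr2.
apply/prodf_neq0 => j ij; rewrite !zE perturb_mul // perturb_div //.
apply: mulf_neq0; first by rewrite invr_eq0.
by apply: mulf_neq0; [exact: k2|exact: k3].
Qed.

Lemma tends_c_near k : tends (c_near^~ k) (c k).
Proof. exact: (@tends_perturb R (c k) (c_exponent k)). Qed.

Lemma tends_x_near i : tends (x_near^~ i) (x i).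
Proof. exact: (@tends_perturb R (x i) (n + i.+1)%:Z). Qed.

End GenericPerturbation.

(** * The determinant evaluation *)

Theorem theorem4p9 (R : realType) (p : R[i]) (hp : 0 < `|p| < 1)
    (n : nat) (x a : 'I_n -> R[i]) (c : 'I_n.+2 -> R[i])
    (hx : forall i, x i != 0) (ha : forall i, a i != 0)
    (hc : forall k, c k != 0)
    (hden : theta p ((\prod_(k < n.+2) c k) * \prod_(i < n) a i) != 0)
    (P : 'I_n -> R[i] -> R[i])
    (hP : forall j : 'I_n,
      A_theta p j.+1
        ((\prod_(k < n.+2) c k) * \prod_(k < n | (j < k)%N) a k)^-1 (P j)) :
  \det (\matrix_(i < n, j < n)
    (x i ^- n.+1 * (\prod_(k < n.+2) theta p (c k * x i)) * P j (x i)
       * (\prod_(k < n | (j < k)%N) theta p (a k * x i))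
     - x i ^+ n.+1 * (\prod_(k < n.+2) theta p (c k * (x i)^-1))
       * P j (x i)^-1
       * (\prod_(k < n | (j < k)%N) theta p (a k * (x i)^-1))))
  = (\prod_(i < n) a i)
      / theta p ((\prod_(k < n.+2) c k) * \prod_(i < n) a i)
    * (\prod_(i < n) P i (1 / a i))
    * (\prod_(i < n.+2) \prod_(j < n.+2 | (i < j)%N) theta p (c i * c j))
    * (\prod_(i < n) ((x i)^-1 * theta p (x i ^+ 2)))
    * (\prod_(i < n) \prod_(j < n | (i < j)%N)
         (a j * (x i)^-1 * theta_pm p (x i) (x j))).
Proof.
pose cn := c_near c; pose xn := x_near x.
have tc k : tends (cn^~ k) (c k) by exact: tends_c_near.
have tx i : tends (xn^~ i) (x i) by exact: tends_x_near.
have hV i : tends (fun N => (xn N i)^-1) (x i)^-1.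
  exact: (@tends_holo R (fun y => y^-1) _ _ (holoV (f := id) (fun y y0 => y0) (@holo_id R)) (hx i) (tx i)).
have ix0 i : (x i)^-1 != 0 by rewrite invr_eq0.
have hth u l : l != 0 -> tends u l -> tends (fun N => theta p (u N)) (theta p l).
  exact: tends_theta.
have hX u l (k : nat) : tends u l -> tends (fun N => u N ^+ k) (l ^+ k).
  move=> hu; elim: k => [|k IH]; first exact: tends_cst.
  rewrite exprS (_ : (fun N => _) = fun N => u N * u N ^+ k); first exact: tendsM hu IH.
  by apply: funext => N; rewrite exprS.
have hPh j : holomorphic_on_punctured_plane (P j) by case: (hP j).
apply: (@tends_unique R
  (fun N => \det (\matrix_(i < n, j < n) det_entry p (cn N) a P j (xn N i)))
  (fun N => (\prod_(i < n) a i)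
      / theta p ((\prod_(k < n.+2) c k) * \prod_(i < n) a i)
    * (\prod_(i < n) P i (1 / a i))
    * (\prod_(i < n.+2) \prod_(j < n.+2 | (i < j)%N) theta p (cn N i * cn N j))
    * (\prod_(i < n) ((xn N i)^-1 * theta p (xn N i ^+ 2)))
    * (\prod_(i < n) \prod_(j < n | (i < j)%N)
         (a j * (xn N i)^-1 * theta_pm p (xn N i) (xn N j))))).
(* Both sides depend continuously on x and c, and agree at nearby generic values. *)
- apply: tends_det => i j; rewrite !mxE.
  rewrite (_ : (fun N => _) = fun N => det_entry p (cn N) a P j (xn N i)); last first.
    by apply: funext => N; rewrite mxE.
  apply: tendsD; last apply: tendsN.
    apply: tendsM; [apply: tendsM; [apply: tendsM|]|].
    + rewrite (_ : (fun N => _) = fun N => (xn N i)^-1 ^+ n.+1); last first.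
        by apply: funext => N; rewrite exprVn.
      by rewrite -exprVn; exact: hX.
    + by apply: tends_prod => k _; apply: hth; [rewrite mulf_neq0|exact: tendsM].
    + exact: tends_holo.
    + apply: tends_prod => k _; apply: hth; first by rewrite mulf_neq0.
      exact: tendsM (@tends_cst R _) (tx i).
  apply: tendsM; [apply: tendsM; [apply: tendsM|]|].
  + exact: hX.
  + by apply: tends_prod => k _; apply: hth; [rewrite mulf_neq0|exact: tendsM].
  + exact: (@tends_holo R (P j) _ _ (hPh j) (ix0 i) (hV i)).
  + apply: tends_prod => k _; apply: hth; first by rewrite mulf_neq0.
    exact: tendsM (@tends_cst R _) (hV i).
- apply: tendsM; [apply: tendsM; [apply: tendsM; first exact: tends_cst|]|].
  + apply: tends_prod => i _; apply: tends_prod => j _.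
    by apply: hth; [rewrite mulf_neq0|exact: tendsM].
  + apply: tends_prod => i _; apply: tendsM; first exact: hV.
    by apply: hth; [rewrite expf_neq0|exact: hX].
  + apply: tends_prod => i _; apply: tends_prod => j _.
    apply: tendsM; first exact: tendsM (@tends_cst R _) (hV i).
    apply: tendsM; (apply: hth; first by rewrite mulf_neq0).
      exact: tendsM (tx i) (tx j).
    exact: tendsM (tx i) (hV j).
apply: filterS (filterI (near_c_distinct hp hc) (filterI (near_c_a hp ha hc)
  (filterI (near_partial_norm hp ha hc hden) (near_hybrid hp hx hc)))).
move=> N [g1 [g2 [g3 g4]]].
have pc := prod_c_near c N; rewrite -/cn in pc.
rewrite -{1}pc; apply: det_C_generic => //.
- by move=> i; exact: x_near_neq0.
- by move=> k; exact: c_near_neq0.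
- by rewrite pc.
- by move=> j; rewrite pc; have /A_thetaE[] := hP j.
- by move=> k kn; rewrite pc; exact: (g3 (Ordinal (kn : (k < n.+1)%N))).
- by move=> k kn; exact: (g4 (Ordinal (kn : (k < n.+1)%N))).
Qed.
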